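(* Let $n\ge1$, $\mathfrak g=\mathfrak{gl}(n+1|n)$ with index set $I=\{1,\dots,2n+1\}$, $p(i)=0$ for $i$ odd and $p(i)=1$ for $i$ even, $f=\sum_{i=1}^{2n}e_{i+1,i}$, and the grading $e_{ij}\in\mathfrak g_{(j-i)/2}$. Let $\mathcal A$ be the $(2n+1)\times(2n+1)$ matrix with entries in $\mathcal V(\bar{\mathfrak p})[D]$ given by $\mathcal A_{ij}=\delta_{ij}D+\bar e^{\,ji}$ for $i\le j$, $\mathcal A_{i+1,i}=-1$, and $\mathcal A_{ij}=0$ for $i>j+1$, where $e^{ji}:=(-1)^{p(j)}e_{ji}$. Write $\operatorname{rdet}(\mathcal A)=\sum_{i=0}^{2n+1}w_{2n+1-i}D^i$ with $w_i\in\mathcal V(\bar{\mathfrak p})$. Then $w_1,\dots,w_{2n+1}\in\mathcal W(\bar{\mathfrak g},f)$ and they freely generate it as a differential algebra: $\mathcal W(\bar{\mathfrak g},f)=\mathbb C[w_i^{(m)}\mid i\in I,\ m\in\mathbb Z_{\ge0}]$.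
   Context: $\mathfrak{gl}$ with parity $p:I\to\{0,1\}$ on the index set is spanned by matrix units $e_{ij}$ of parity $p(i)+p(j)$, with $[e_{ij},e_{kl}]=\delta_{jk}e_{il}-(-1)^{(p(i)+p(j))(p(k)+p(l))}\delta_{il}e_{kj}$, supertrace $\operatorname{str}(\sum a_{ij}e_{ij})=\sum(-1)^{p(i)}a_{ii}$, and bilinear form $(X|Y)=\operatorname{str}(XY)$, i.e. $(e_{ij}|e_{kl})=\delta_{jk}\delta_{il}(-1)^{p(i)}$. For a Lie superalgebra $\mathfrak a$ with even supersymmetric invariant form, $\bar{\mathfrak a}=\{\bar a\}$ is a parity-reversed copy ($p(\bar a)=p(a)+1$), and $\mathcal V(\bar{\mathfrak a})=S(\mathbb C[D]\otimes\bar{\mathfrak a})$ is the free supercommutative algebra on the symbols $D^m\bar a$ with odd derivation $D$, made into a SUSY Poisson vertex algebra (level 1) by $\{\bar a{}_\chi\bar b\}=(-1)^{p(a)(p(b)+1)}\overline{[a,b]}+\chi(a|b)$, extended by sesquilinearity $\{Dx{}_\chi y\}=-\chi\{x{}_\chi y\}$, $\{x{}_\chi Dy\}=(-1)^{p(x)+1}(D+\chi)\{x{}_\chi y\}$ and the Leibniz rule $\{x{}_\chi yz\}=(-1)^{(p(x)+1)p(y)}y\{x{}_\chi z\}+\{x{}_\chi y\}z$ (and skewsymmetry); $\chi$ is odd, supercommutes with $\mathcal V$, and $D\chi+\chi D=-2\chi^2$. Write $x^{(m)}=D^mx$. SUSY classical $W$-algebra: given a grading $\mathfrak g=\bigoplus_{j\in\frac12\mathbb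 Z}\mathfrak g_j$ and odd $f\in\mathfrak g_{-1/2}$, set $\mathfrak n=\bigoplus_{j>0}\mathfrak g_j$, $\mathfrak p=\bigoplus_{j\le0}\mathfrak g_j$, $\mathcal V(\bar{\mathfrak p})=S(\mathbb C[D]\otimes\bar{\mathfrak p})\subset\mathcal V(\bar{\mathfrak g})$, $\mathfrak J$ = differential ideal of $\mathcal V(\bar{\mathfrak g})$ generated by $\{\bar n-(f|n):n\in\mathfrak n\}$, and $\mathcal W(\bar{\mathfrak g},f)=\{w\in\mathcal V(\bar{\mathfrak p}):\{\bar n{}_\chi w\}\in\mathbb C[\chi]\otimes\mathfrak J\ \forall n\in\mathfrak n\}$. ''Freely generate'' means the $w_i^{(m)}$ are free supercommutative generators of $\mathcal W$. $\mathcal V(\bar{\mathfrak p})[D]$ has product determined by $D\,a=D(a)+(-1)^{p(a)}aD$; coefficients are written to the left of powers of $D$. For an $N\times N$ matrix with entries in an associative algebra, $\operatorname{rdet}(A)=\sum_{\sigma\in S_N}\operatorname{sgn}(\sigma)A_{1\sigma(1)}A_{2\sigma(2)}\cdots A_{N\sigma(N)}$. *)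

(* Defs.v *)
From HB Require Import structures.
From mathcomp Require Import all_boot all_order all_algebra.
From mathcomp Require Import perm complex Rstruct.
Set Implicit Arguments. Unset Strict Implicit. Unset Printing Implicit Defensive.
Import GRing.Theory.
Local Open Scope ring_scope.

Definition CC : fieldType := (Rdefinitions.R)[i].

Definition sgn (b : bool) : CC := if b then -1 else 1.

(* Free supercommutative algebra S over CC on a countable set X of     *)
(* homogeneous generators with parity par.  An element is represented  *)
(* by a finite formal sum of (coefficient, word in the generators);    *)
(* two representatives are equal in S iff they have the same           *)
(* coefficients on normal monomials, obtained by sorting a word with    *)
(* the Koszul sign (odd generators anticommute, odd squares vanish).    *)
Section Super.
Variables (X : countType) (par : X -> bool).

Definition sc := seq (CC * seq X)%type.

Definition wpar (w : seq X) : bool := foldr (fun x b => par x (+) b) false w.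

(* insert x into a sorted word, returning the Koszul sign, or None if zero *)
Fixpoint ins (x : X) (s : seq X) : option (bool * seq X) :=
  match s with
  | [::] => Some (false, [:: x])
  | y :: s' =>
      if (pickle x < pickle y)%N then Some (false, x :: s)
      else if x == y then (if par x then None else Some (false, x :: s))
      else match ins x s' with
           | None => None
           | Some (b, t) => Some ((par x && par y) (+) b, y :: t)
           end
  end.

Fixpoint normw (w : seq X) : option (bool * seq X) :=
  match w with
  | [::] => Some (false, [::])
  | x :: w' =>
      match normw w' with
      | None => None
      | Some (b, s) =>
          match ins x s with
          | None => None
          | Some (b', t) => Some (b (+) b', t)
          end
      end
  end.

Definition coef (p : sc) (m : seq X) : CC :=
  \sum_(t <- p) match normw t.2 with
                | Some (b, s) => if s == m then sgn b * t.1 else 0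
                | None => 0
                end.

Definition sceq (p q : sc) : Prop := forall m, coef p m = coef q m.

Definition sc0 : sc := [::].
Definition sc1 : sc := [:: (1, [::])].
Definition sccst (c : CC) : sc := [:: (c, [::])].
Definition scgen (x : X) : sc := [:: (1, [:: x])].
Definition scadd (p q : sc) : sc := p ++ q.
Definition scscale (c : CC) (p : sc) : sc := [seq (c * t.1, t.2) | t <- p].
Definition scopp (p : sc) : sc := scscale (-1) p.
Definition scmul (p q : sc) : sc :=
  [seq (t.1 * u.1, t.2 ++ u.2) | t <- p, u <- q].
Definition scsgn (p : sc) : sc := [seq (sgn (wpar t.2) * t.1, t.2) | t <- p].

End Super.

(* gl(n+1|n), index set I = {1,..,2n+1} represented by 'I_(2n+1)       *)
(* (0-based: k : 'I_N stands for the index k+1).                         *)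
Section GL.
Variable n : nat.

Definition N : nat := (n.*2).+1.
Definition Idx := 'I_N.

(* p(i) = 0 for i odd, 1 for i even (1-based), i.e. odd k for k 0-based *)
Definition pI (k : Idx) : bool := odd k.

Definition str (A : 'M[CC]_N) : CC := \sum_(i < N) sgn (pI i) * A i i.
Definition form (A B : 'M[CC]_N) : CC := str (A *m B).

Definition sbr (i j k l : Idx) : 'M[CC]_N :=
  (if j == k then delta_mx i l else 0)
  - sgn ((pI i (+) pI j) && (pI k (+) pI l)) *:
      (if i == l then delta_mx k j else 0).

Definition fmat : 'M[CC]_N := \matrix_(i, j) (if (i == j.+1 :> nat) then 1 else 0).

(* grading: e_ij in g_{(j-i)/2}; n = positive part, p = nonpositive part *)
Definition in_n (A : 'M[CC]_N) : Prop := forall i j : Idx, ~~ (i < j)%N -> A i j = 0.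

(* generators D^m bar(e_ij) of V(bar g) : (i, j, m) *)
Definition Gen := (Idx * Idx * nat)%type.
Definition parG (g : Gen) : bool := pI g.1.1 (+) pI g.1.2 (+) ~~ odd g.2.
Definition isP (g : Gen) : bool := (g.1.2 <= g.1.1)%N.

Definition V := sc Gen.

Definition genV (g : Gen) : V := scgen g.
Definition barV (A : 'M[CC]_N) : V :=
  [seq (A i j, [:: (i, j, 0%N)]) | i <- enum 'I_N, j <- enum 'I_N].

Definition Dg (g : Gen) : Gen := (g.1, g.2.+1).
Fixpoint Dw (w : seq Gen) : seq (bool * seq Gen) :=
  match w with
  | [::] => [::]
  | x :: w' => (false, Dg x :: w') :: [seq (parG x (+) b.1, x :: b.2) | b <- Dw w']
  end.
Definition DV (p : V) : V :=
  flatten [seq [seq (sgn b.1 * t.1, b.2) | b <- Dw t.2] | t <- p].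

Definition inVp (x : V) : Prop :=
  forall m, coef parG x m <> 0 -> all isP m.

Definition isJideal (I : V -> Prop) : Prop :=
  (forall x y, sceq parG x y -> I x -> I y) /\
  I (sc0 Gen) /\
  (forall x y, I x -> I y -> I (scadd x y)) /\
  (forall x y, I y -> I (scmul x y)) /\
  (forall x y, I x -> I (scmul x y)) /\
  (forall x, I x -> I (DV x)) /\
  (forall A, in_n A -> I (scadd (barV A) (sccst Gen (- form fmat A)))).
Definition inJ (x : V) : Prop := forall I, isJideal I -> I x.

(* C[chi] (x) V : list of coefficients of chi^0, chi^1, ... *)
Definition VX := seq V.
Definition vxadd (p q : VX) : VX :=
  mkseq (fun k => scadd (nth [::] p k) (nth [::] q k)) (maxn (size p) (size q)).
Definition vxscale (c : CC) (p : VX) : VX := [seq scscale c v | v <- p].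
Definition vxchi (p : VX) : VX := [::] :: p.
(* D on C[chi] (x) V, using D chi + chi D = -2 chi^2 (so chi^2 D = D chi^2) *)
Definition vxD (p : VX) : VX :=
  mkseq (fun k =>
     scadd (if odd k then scopp (DV (nth [::] p k)) else DV (nth [::] p k))
           (if odd k then [::] else
              if k is k'.+1 then scscale (-2) (nth [::] p k') else [::]))
        (size p).+1.
(* y (chi^k v) = (-1)^{k p(y)} chi^k (y v), for y homogeneous of parity b *)
Definition vxlmul (y : V) (b : bool) (p : VX) : VX :=
  mkseq (fun k => scmul (if b && odd k then scopp y else y) (nth [::] p k)) (size p).
Definition vxrmul (p : VX) (z : V) : VX := [seq scmul v z | v <- p].

Definition br0 (a b c d : Idx) : VX :=
  [:: scscale (sgn ((pI a (+) pI b) && ~~ (pI c (+) pI d))) (barV (sbr a b c d));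
      sccst Gen (form (delta_mx a b) (delta_mx c d))].
(* { x _chi D^m y } via {x _chi D y} = (-1)^{p(x)+1} (D + chi) {x _chi y},
   with x = bar e_ab of parity p(a)+p(b)+1 *)
Definition brgen (a b : Idx) (g : Gen) : VX :=
  iter g.2 (fun p => vxscale (sgn (pI a (+) pI b)) (vxadd (vxD p) (vxchi p)))
       (br0 a b g.1.1 g.1.2).
(* Leibniz rule {x _chi y z} = (-1)^{(p(x)+1)p(y)} y {x _chi z} + {x _chi y} z *)
Fixpoint brw (a b : Idx) (w : seq Gen) : VX :=
  match w with
  | [::] => [::]
  | y :: z => vxadd
      (vxscale (sgn ((pI a (+) pI b) && parG y)) (vxlmul (genV y) (parG y) (brw a b z)))
      (vxrmul (brgen a b y) [:: (1, z)])
  end.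
Definition brV (a b : Idx) (v : V) : VX :=
  foldr vxadd [::] [seq vxscale t.1 (brw a b t.2) | t <- v].
Definition brA (A : 'M[CC]_N) (v : V) : VX :=
  foldr vxadd [::] [seq vxscale (A i j) (brV i j v) | i <- enum 'I_N, j <- enum 'I_N].

Definition inW (w : V) : Prop :=
  inVp w /\ forall A, in_n A -> forall k, inJ (nth [::] (brA A w) k).

(* V(bar p)[D]: list of coefficients of D^0, D^1, ...; coefficients on the left *)
Definition VD := seq V.
Definition vdadd (p q : VD) : VD :=
  mkseq (fun k => scadd (nth [::] p k) (nth [::] q k)) (maxn (size p) (size q)).
Definition vdscale (c : CC) (p : VD) : VD := [seq scscale c v | v <- p].
(* D (sum b_i D^i) = sum (D b_i) D^i + sum (-1)^{p(b_i)} b_i D^{i+1} *)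
Definition vdleftD (q : VD) : VD := vdadd (map DV q) ([::] :: map (@scsgn _ parG) q).
Definition vdlmul (a : V) (q : VD) : VD := [seq scmul a v | v <- q].
Definition vdmul (p q : VD) : VD :=
  foldr vdadd [::] [seq vdlmul (nth [::] p i) (iter i vdleftD q) | i <- iota 0 (size p)].
Definition vd1 : VD := [:: sc1 Gen].

Definition Aent (i j : Idx) : VD :=
  if (i <= j)%N then
    [:: [:: (sgn (pI j), [:: (j, i, 0%N)])]; if i == j then sc1 Gen else [::]]
  else if (i == j.+1 :> nat) then [:: sccst Gen (-1)] else [::].

Definition rdet : VD :=
  foldr vdadd [::]
    [seq vdscale (sgn (odd_perm s)) (foldr vdmul vd1 [seq Aent i (s i) | i <- enum 'I_N])
    | s <- enum {perm 'I_N}].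

Definition wcoef (k : nat) : V := nth [::] rdet (N - k).

(* free generation: symbols (k, m) stand for w_{k+1}^{(m)}, of parity k+1+m *)
Definition Sym := (Idx * nat)%type.
Definition parY (y : Sym) : bool := odd (y.1.+1 + y.2).
Definition wY (y : Sym) : V := iter y.2 DV (wcoef y.1.+1).
Definition evalY (P : sc Sym) : V :=
  flatten [seq scscale t.1 (foldr (@scmul Gen) (sc1 Gen) (map wY t.2)) | t <- P].

End GL.

(* Main.v *)
From HB Require Import structures.
From mathcomp Require Import all_boot all_order all_algebra.
From mathcomp Require Import perm complex Rstruct boolp zify.
Require Import Defs.

(** Modulo the differential ideal J, the differential superalgebra generated by gl becomes
    the one generated by p (this is the map [rho]), and the coefficient of chi^k in the
    bracket with e_ab is a superderivation of parity p(a)+p(b)+k.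

    The w_k are invariant.  With rows and columns counted from 0, the row determinant of the
    Hessenberg matrix A is S_0, where S_N = 1 and S_i = sum_(j >= i) A_ij S_(j+1).
    Descending induction on i along this recursion shows that, modulo J, the bracket with
    e_ab (a < b) kills every S_i except S_(a+1), which it sends to - S_(b+1).

    The w_k are free.  The homomorphism [eta] that kills the generators in the entries of A
    outside row 0 sends w_k to the generator in row 0 and column k-1, so it sends a
    differential polynomial in the w_k to the same polynomial in these generators.

    The w_k generate.  It is enough that [eta] is injective on W.  Let s in W be nonzero and
    look at its monomials of least weight, for the weight [wt].  If one of them contained
    e_ji^(l) with i > 0, then in the chi^l coefficient of the bracket of s with e_(i-1,j) the
    lowest part would be a nonzero multiple of the partial derivative of s along e_ji^(l),
    which contradicts invariance.  Hence these monomials only involve the generators in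
    row 0, which [eta] does not kill. *)

Set Implicit Arguments. Unset Strict Implicit. Unset Printing Implicit Defensive.
Import Order.TTheory GRing.Theory Num.Theory.
Local Open Scope ring_scope.
Local Open Scope quotient_scope.

(** * Signs and scalars *)

Lemma CC_natr_eq0 (k : nat) : ((k%:R : CC) == 0) = (k == 0%N).
Proof. exact: (@pnatr_eq0 ((Rdefinitions.R)[i])). Qed.

Lemma sgnD a b : sgn (a (+) b) = sgn a * sgn b.
Proof. by case: a; case: b; rewrite /sgn /= ?mulr1 ?mul1r ?mulrNN ?mulr1. Qed.

Lemma sgnK b : sgn b * sgn b = 1.
Proof. by rewrite -sgnD addbb. Qed.

Lemma sgn_neq0 b : sgn b != 0.
Proof. by case: b; rewrite /sgn ?oppr_eq0 oner_eq0. Qed.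

Lemma sgnN b : sgn (~~ b) = - sgn b.
Proof. by case: b; rewrite /sgn ?opprK. Qed.

(** The characteristic is not 2. This makes a repeated odd letter vanish under any map that obeys
    the sign rule. *)
Lemma lmod_opp_eq0 (M : lmodType CC) (v : M) : v = - v -> v = 0.
Proof.
move=> /eqP; rewrite -subr_eq0 opprK -mulr2n -scaler_nat scaler_eq0 CC_natr_eq0.
by move=> /eqP.
Qed.

(** * The free supercommutative algebra as a quotient ring *)

Section Normalization.
Variables (X : countType) (par : X -> bool).

Definition obind_ins (x : X) (o : option (bool * seq X)) :=
  match o with
  | None => None
  | Some (b, s) =>
      match ins par x s with
      | None => None
      | Some (b', t) => Some (b (+) b', t)
      end
  end.

Definition oflip (c : bool) (o : option (bool * seq X)) :=
  if o is Some (b, s) then Some (c (+) b, s) else None.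

Lemma normw_cons x w : normw par (x :: w) = obind_ins x (normw par w).
Proof. by []. Qed.

Lemma obind_ins_flip c x o : obind_ins x (oflip c o) = oflip c (obind_ins x o).
Proof.
by case: o => [[b s]|] //=; case: (ins par x s) => [[b' t]|] //=; rewrite addbA.
Qed.

Lemma oflipK c : involutive (oflip c).
Proof. by case=> [[b s]|] //=; rewrite addbA addbb. Qed.

(** Either the first insertion already fails, or the second one scans past the same letters and
    meets the odd copy just inserted. *)
Lemma ins_odd_square x s : par x -> obind_ins x (ins par x s) = None.
Proof.
move=> px; elim: s => [|z s IH] /=; first by rewrite ltnn eqxx px.
case: (ltngtP (pickle x) (pickle z)) => [lxz|lzx|/(pcan_inj pickleK) exz].
- by rewrite /= ltnn eqxx px.
- have nxz : (x == z) = false by apply/eqP=> xz; rewrite xz ltnn in lzx.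
  rewrite nxz; case E: (ins par x s) IH => [[b t]|] //=.
  rewrite (ltnNge (pickle x)) (ltnW lzx) /= nxz.
  by case: (ins par x t) => [[]|].
- by rewrite exz eqxx -exz px.
Qed.

(** Both orders end in the same list. On the right [y] has to cross the smaller letter [x], on the
    left [x] stops before it reaches [y]; this one crossing is the sign. *)
Lemma ins_swap_lt x y s : (pickle x < pickle y)%N ->
  obind_ins x (ins par y s) = oflip (par x && par y) (obind_ins y (ins par x s)).
Proof.
move=> lxy; have nyx : (pickle y < pickle x)%N = false by rewrite ltnNge ltnW.
have neyx : (y == x) = false by apply/eqP=> yx; rewrite yx ltnn in lxy.
elim: s => [|z s IH] /=.
  by rewrite lxy nyx neyx /=; case: (par x); case: (par y).
case: (ltngtP (pickle y) (pickle z)) => [lyz|lzy|/(pcan_inj pickleK) <-].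
- have lxz := ltn_trans lxy lyz; rewrite lxz /= lxy nyx neyx lyz /=.
  by case: (par x); case: (par y).
- have neyz : (y == z) = false by apply/eqP=> yz; rewrite yz ltnn in lzy.
  rewrite neyz.
  case: (ltngtP (pickle x) (pickle z)) => [lxz|lzx|/(pcan_inj pickleK) exz].
  + rewrite /= nyx neyx (ltnNge (pickle y)) (ltnW lzy) /= neyz.
    case: (ins par y s) => [[b t]|] //=; rewrite lxz /=.
    by case: b; case: (par x); case: (par y); case: (par z).
  + have nexz : (x == z) = false by apply/eqP=> xz; rewrite xz ltnn in lzx.
    rewrite nexz.
    case: (ins par y s) (ins par x s) IH => [[b t]|] [[c u]|] //=.
    * rewrite (ltnNge (pickle y)) (ltnW lzy) (ltnNge (pickle x)) (ltnW lzx) /=.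
      rewrite nexz neyz.
      case: (ins par x t) (ins par y u) => [[b' t']|] [[c' u']|] //= [eb ->].
      congr (Some (_, _)); move: eb.
      by case: b; case: b'; case: c; case: c'; case: (par x); case: (par y);
         case: (par z).
    * rewrite (ltnNge (pickle x)) (ltnW lzx) /= nexz.
      by case: (ins par x t) => [[]|].
    * rewrite (ltnNge (pickle y)) (ltnW lzy) /= neyz.
      by case: (ins par y u) => [[]|].
  + subst z; rewrite eqxx; case px: (par x).
      case: (ins par y s) => [[b t]|] //=.
      by rewrite ltnn eqxx px.
    rewrite /= nyx neyx.
    case: (ins par y s) => [[b t]|] //=.
    by rewrite ltnn eqxx px andbF /= addbF.
- rewrite eqxx lxy /= nyx neyx ltnn eqxx.
  case: (par y) => //=; rewrite lxy /=; by case: (par x).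
Qed.

Lemma ins_swap x y s :
  obind_ins x (ins par y s) = oflip (par x && par y) (obind_ins y (ins par x s)).
Proof.
case: (ltngtP (pickle x) (pickle y)) => [lxy|lyx|/(pcan_inj pickleK) <-].
- exact: ins_swap_lt.
- by rewrite (ins_swap_lt _ lyx) andbC oflipK.
- case px: (par x); first by rewrite ins_odd_square.
  by case: obind_ins => [[]|].
Qed.

Lemma normw_swap u x y v :
  normw par (u ++ x :: y :: v) =
  oflip (par x && par y) (normw par (u ++ y :: x :: v)).
Proof.
elim: u => [|z u IH]; last by rewrite !cat_cons !normw_cons IH obind_ins_flip.
rewrite !cat0s !normw_cons; case: (normw par v) => [[b s]|] //.
have h z t : obind_ins z (obind_ins t (Some (b, s))) =
             oflip b (obind_ins z (ins par t s)).
  rewrite -obind_ins_flip /=; case: (ins par t s) => [[]|] //=.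
by rewrite !h ins_swap; case: obind_ins => [[c t]|] //=; rewrite addbCA.
Qed.

Definition wcoefw (w m : seq X) : CC :=
  if normw par w is Some (b, s) then (if s == m then sgn b else 0) else 0.

Lemma coefE (p : sc X) m : coef par p m = \sum_(t <- p) t.1 * wcoefw t.2 m.
Proof.
apply: eq_bigr => t _; rewrite /wcoefw; case: (normw par t.2) => [[b s]|].
  by case: ifP; rewrite ?mulr0 // mulrC.
by rewrite mulr0.
Qed.

(** The sign rule on adjacent letters, which is what a function on words needs in order to extend
    linearly to the quotient. With [x = y] odd it contains the vanishing of odd squares. *)
Definition swapok (M : lmodType CC) (F : seq X -> M) : Prop :=
  forall u x y v, F (u ++ x :: y :: v) =
    sgn (par x && par y) *: F (u ++ y :: x :: v).

Lemma wcoefw_swap m : swapok (fun w => wcoefw w m : CC^o).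
Proof.
move=> u x y v; rewrite /wcoefw normw_swap.
case: (normw par (u ++ y :: x :: v)) => [[b s]|] /=; last by rewrite scaler0.
by case: (s == m); rewrite ?scaler0 // sgnD.
Qed.

(** Insertion sort uses only adjacent swaps, and a repeated odd letter gives [F = - F]. The prefix
    [u] collects the letters that the induction has already passed. *)
Lemma swapok_norm (M : lmodType CC) (F : seq X -> M) : swapok F -> forall u w,
  F (u ++ w) = if normw par w is Some (b, s) then sgn b *: F (u ++ s) else 0.
Proof.
move=> ok u w; elim: w u => [|x w IH] u /=; first by rewrite scale1r.
rewrite -cat_rcons IH; case: (normw par w) => [[b s]|] //.
suff h v : F (v ++ x :: s) =
    if ins par x s is Some (b', t) then sgn b' *: F (v ++ t) else 0.
  rewrite cat_rcons h; case: (ins par x s) => [[b' t]|]; last by rewrite scaler0.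
  by rewrite scalerA sgnD.
elim: s v {b} => [|z s IHs] v /=; first by rewrite scale1r.
case: ifP => _; first by rewrite scale1r.
case: eqP => [<-|_].
  case px: (par x); last by rewrite scale1r.
  by apply: lmod_opp_eq0; rewrite {1}ok px /sgn /= scaleN1r.
rewrite ok -cat_rcons IHs; case: (ins par x s) => [[b t]|]; last by rewrite scaler0.
by rewrite scalerA sgnD cat_rcons.
Qed.

(** [L] may be larger than the set of normal forms of [p], so that two equivalent representatives
    can be expanded over one common list. *)
Lemma swapok_coef (M : lmodType CC) (F : seq X -> M) (L : seq (seq X)) p :
  swapok F -> uniq L ->
  (forall t b s, t \in p -> normw par t.2 = Some (b, s) -> s \in L) ->
  \sum_(t <- p) t.1 *: F t.2 = \sum_(m <- L) coef par p m *: F m.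
Proof.
move=> ok uL hL.
under [RHS]eq_bigr => m _ do rewrite coefE scaler_suml.
rewrite exchange_big /= big_seq [RHS]big_seq; apply: eq_bigr => t tp.
rewrite -{1}[t.2]cat0s (swapok_norm ok) /wcoefw.
case E: (normw par t.2) => [[b s]|]; last first.
  by rewrite scaler0 big1 // => m _; rewrite mulr0 scale0r.
rewrite (bigD1_seq s) //=; last exact: hL E.
rewrite eqxx big1 ?addr0 ?scalerA // => m /negbTE.
by rewrite eq_sym => ->; rewrite mulr0 scale0r.
Qed.

Lemma swapok_sceq (M : lmodType CC) (F : seq X -> M) p q : swapok F ->
  sceq par p q -> \sum_(t <- p) t.1 *: F t.2 = \sum_(t <- q) t.1 *: F t.2.
Proof.
move=> ok pq.
pose nf (t : CC * seq X) := if normw par t.2 is Some (b, s) then s else [::].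
pose L := undup (map nf (p ++ q)).
have hL (r : seq (CC * seq X)) : {subset r <= p ++ q} -> forall t b s, t \in r ->
    normw par t.2 = Some (b, s) -> s \in L.
  move=> sub t b s tr E; rewrite mem_undup; apply/mapP; exists t; first exact: sub.
  by rewrite /nf E.
rewrite (swapok_coef ok (undup_uniq _) (hL p _)); last first.
  by move=> t tp; rewrite mem_cat tp.
rewrite (swapok_coef ok (undup_uniq _) (hL q _)); last first.
  by move=> t tp; rewrite mem_cat tp orbT.
by apply: eq_bigr => m _; rewrite pq.
Qed.

Definition sceqb (p q : sc X) : bool := `[< sceq par p q >].

Lemma sceqb_refl : reflexive sceqb.
Proof. by move=> p; apply/asboolP. Qed.
Lemma sceqb_sym : symmetric sceqb.
Proof. by move=> p q; apply/asboolP/asboolP => h m; rewrite h. Qed.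
Lemma sceqb_trans : transitive sceqb.
Proof. by move=> q p r /asboolP h /asboolP k; apply/asboolP => m; rewrite h k. Qed.

Canonical sceqb_equiv := EquivRel sceqb sceqb_refl sceqb_sym sceqb_trans.

Definition superalg := {eq_quot sceqb}.
HB.instance Definition _ := Choice.on superalg.
HB.instance Definition _ := EqQuotient.on superalg.

Definition cls (p : sc X) : superalg := \pi p.

Lemma clsP p q : cls p = cls q <-> sceq par p q.
Proof. by split=> [/eqmodP/asboolP|h] //; apply/eqmodP/asboolP. Qed.

Lemma cls_repr s : cls (repr s) = s.
Proof. exact: reprK. Qed.

Lemma cls_ind (P : superalg -> Prop) : (forall p, P (cls p)) -> forall s, P s.
Proof. by move=> h s; rewrite -(cls_repr s). Qed.

Definition coefS (s : superalg) m : CC := coef par (repr s) m.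

Lemma coefS_cls p m : coefS (cls p) m = coef par p m.
Proof. by have /clsP := cls_repr (cls p); apply. Qed.

Lemma coefS_inj s t : coefS s =1 coefS t -> s = t.
Proof. by move=> h; rewrite -(cls_repr s) -(cls_repr t); apply/clsP. Qed.

Lemma coef_cat (p q : sc X) m : coef par (p ++ q) m = coef par p m + coef par q m.
Proof. exact: big_cat. Qed.
Lemma coef_scale c (p : sc X) m : coef par (scscale c p) m = c * coef par p m.
Proof.
by rewrite !coefE big_map mulr_sumr; apply: eq_bigr => t _; rewrite mulrA.
Qed.
Lemma coef_nil m : coef par [::] m = 0.
Proof. exact: big_nil. Qed.
Lemma coef_mul (p q : sc X) m :
  coef par (scmul p q) m =
  \sum_(t <- p) t.1 * \sum_(u <- q) u.1 * wcoefw (t.2 ++ u.2) m.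
Proof.
rewrite coefE /scmul big_allpairs_dep; apply: eq_bigr => t _ /=; rewrite mulr_sumr.
by apply: eq_bigr => u _; rewrite mulrA.
Qed.

Lemma coef_mulC (p q : sc X) m :
  coef par (scmul p q) m =
  \sum_(u <- q) u.1 * \sum_(t <- p) t.1 * wcoefw (t.2 ++ u.2) m.
Proof.
rewrite coef_mul; under eq_bigr do rewrite mulr_sumr.
rewrite exchange_big; apply: eq_bigr => u _ /=; rewrite mulr_sumr.
by apply: eq_bigr => t _; rewrite mulrCA.
Qed.

(** One factor is changed at a time: with the other factor fixed, a coefficient of the product is a
    function of the word that obeys the sign rule. *)
Lemma scmul_sceq p p' q q' : sceq par p p' -> sceq par q q' ->
  sceq par (scmul p q) (scmul p' q').
Proof.
move=> pp qq m; rewrite coef_mul.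
transitivity (coef par (scmul p' q) m).
  rewrite coef_mul; apply: (@swapok_sceq CC^o
    (fun w => \sum_(u <- q) u.1 * wcoefw (w ++ u.2) m) p p' _ pp).
  move=> u x y v; rewrite scaler_sumr; apply: eq_bigr => t _.
  by rewrite -!catA !cat_cons [wcoefw _ _]wcoefw_swap; exact: mulrCA.
rewrite !coef_mulC; apply: (@swapok_sceq CC^o
    (fun w => \sum_(u <- p') u.1 * wcoefw (u.2 ++ w) m) q q' _ qq).
move=> u x y v; rewrite scaler_sumr; apply: eq_bigr => t _.
by rewrite !catA [wcoefw _ _]wcoefw_swap; exact: mulrCA.
Qed.

Definition addS (s t : superalg) := cls (scadd (repr s) (repr t)).
Definition scaleS c (s : superalg) := cls (scscale c (repr s)).
Definition oppS (s : superalg) := scaleS (-1) s.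
Definition mulS (s t : superalg) := cls (scmul (repr s) (repr t)).

Lemma reprP p : sceq par (repr (cls p)) p.
Proof. by apply/clsP; rewrite cls_repr. Qed.

Lemma coefS_add s t m : coefS (addS s t) m = coefS s m + coefS t m.
Proof. by rewrite coefS_cls coef_cat. Qed.
Lemma coefS_scale c s m : coefS (scaleS c s) m = c * coefS s m.
Proof. by rewrite coefS_cls coef_scale. Qed.
Lemma mulS_cls p q : mulS (cls p) (cls q) = cls (scmul p q).
Proof. by apply/clsP/scmul_sceq; apply: reprP. Qed.

Lemma addSA : associative addS.
Proof. by move=> s t u; apply: coefS_inj => m; rewrite !coefS_add addrA. Qed.
Lemma addSC : commutative addS.
Proof. by move=> s t; apply: coefS_inj => m; rewrite !coefS_add addrC. Qed.
Lemma add0S : left_id (cls [::]) addS.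
Proof.
by move=> s; apply: coefS_inj => m; rewrite coefS_add coefS_cls coef_nil add0r.
Qed.
Lemma addNS : left_inverse (cls [::]) oppS addS.
Proof.
move=> s; apply: coefS_inj => m.
by rewrite coefS_add coefS_scale mulN1r addNr coefS_cls coef_nil.
Qed.

HB.instance Definition _ := GRing.isZmodule.Build superalg addSA addSC add0S addNS.

Lemma scaleSA a b s : scaleS a (scaleS b s) = scaleS (a * b) s.
Proof. by apply: coefS_inj => m; rewrite !coefS_scale mulrA. Qed.
Lemma scale1S : left_id 1 scaleS.
Proof. by move=> s; apply: coefS_inj => m; rewrite !coefS_scale mul1r. Qed.
Lemma scaleSDr : right_distributive scaleS +%R.
Proof.
by move=> a s t; apply: coefS_inj => m; rewrite !(coefS_scale, coefS_add) mulrDr.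
Qed.
Lemma scaleSDl s : {morph scaleS^~ s : a b / a + b}.
Proof.
by move=> a b; apply: coefS_inj => m; rewrite !(coefS_scale, coefS_add) mulrDl.
Qed.

HB.instance Definition _ := GRing.Zmodule_isLmodule.Build CC superalg
  scaleSA scale1S scaleSDr scaleSDl.

Lemma coefS0 m : coefS 0 m = 0. Proof. by rewrite coefS_cls coef_nil. Qed.
Lemma coefSD s t m : coefS (s + t) m = coefS s m + coefS t m.
Proof. exact: coefS_add. Qed.
Lemma coefSZ c s m : coefS (c *: s) m = c * coefS s m.
Proof. exact: coefS_scale. Qed.
Lemma coefS_sum (I : Type) (r : seq I) (P : pred I) (F : I -> superalg) m :
  coefS (\sum_(i <- r | P i) F i) m = \sum_(i <- r | P i) coefS (F i) m.
Proof.
by apply: (big_morph (coefS^~ m)) => [s t|]; rewrite ?coefSD ?coefS0.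
Qed.

Lemma cls_add p q : cls (scadd p q) = cls p + cls q.
Proof. by apply: coefS_inj => m; rewrite coefSD !coefS_cls coef_cat. Qed.
Lemma cls_scale c p : cls (scscale c p) = c *: cls p.
Proof. by apply: coefS_inj => m; rewrite coefSZ !coefS_cls coef_scale. Qed.

Definition mon (w : seq X) : superalg := cls [:: (1, w)].

Lemma cls_sum p : cls p = \sum_(t <- p) t.1 *: mon t.2.
Proof.
apply: coefS_inj => m; rewrite coefS_cls coefE coefS_sum.
by apply: eq_bigr => t _; rewrite coefSZ coefS_cls coefE big_seq1 mul1r.
Qed.

Lemma mulSA : associative mulS.
Proof.
elim/cls_ind=> p; elim/cls_ind=> q; elim/cls_ind=> r; rewrite !mulS_cls.
apply/clsP => m; rewrite !coefE /scmul !big_allpairs_dep /=; apply: eq_bigr => t _ /=.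
rewrite big_allpairs_dep; apply: eq_bigr => u _ /=.
by apply: eq_bigr => v _; rewrite /= catA mulrA.
Qed.
Lemma mul1S : left_id (mon [::]) mulS.
Proof.
elim/cls_ind=> p; rewrite mulS_cls; apply/clsP => m.
by rewrite coef_mul big_seq1 mul1r coefE.
Qed.
Lemma mulS1 : right_id (mon [::]) mulS.
Proof.
elim/cls_ind=> p; rewrite mulS_cls; apply/clsP => m.
rewrite coef_mul coefE; apply: eq_bigr => t _.
by rewrite big_seq1 mul1r cats0.
Qed.
Lemma mulSDl : left_distributive mulS +%R.
Proof.
elim/cls_ind=> p; elim/cls_ind=> q; elim/cls_ind=> r; rewrite -cls_add !mulS_cls.
by rewrite -cls_add; apply/clsP => m; rewrite coef_cat !coef_mul big_cat.
Qed.
Lemma mulSDr : right_distributive mulS +%R.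
Proof.
elim/cls_ind=> p; elim/cls_ind=> q; elim/cls_ind=> r; rewrite -cls_add !mulS_cls.
by rewrite -cls_add; apply/clsP => m; rewrite coef_cat !coef_mulC big_cat.
Qed.
Lemma one_neq0S : mon [::] != 0.
Proof.
apply/eqP => /(congr1 (coefS^~ [::])); rewrite coefS0 coefS_cls coefE big_seq1.
by rewrite /wcoefw /= mul1r => /eqP; rewrite oner_eq0.
Qed.

HB.instance Definition _ := GRing.Zmodule_isNzRing.Build superalg
  mulSA mul1S mulS1 mulSDl mulSDr one_neq0S.

Lemma cls_mul p q : cls (scmul p q) = cls p * cls q.
Proof. by rewrite -mulS_cls. Qed.

Lemma scaleSAl (c : CC) (s t : superalg) : c *: (s * t) = (c *: s) * t.
Proof.
elim/cls_ind: s => p; elim/cls_ind: t => q; rewrite -cls_scale -!cls_mul -cls_scale.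
apply/clsP => m; rewrite coef_scale !coef_mul big_map mulr_sumr.
by apply: eq_bigr => t _; rewrite mulrA.
Qed.
HB.instance Definition _ := GRing.Lmodule_isLalgebra.Build CC superalg scaleSAl.

Lemma scaleSAr (c : CC) (s t : superalg) : c *: (s * t) = s * (c *: t).
Proof.
elim/cls_ind: s => p; elim/cls_ind: t => q; rewrite -cls_scale -!cls_mul -cls_scale.
apply/clsP => m; rewrite coef_scale !coef_mulC big_map mulr_sumr.
by apply: eq_bigr => t _; rewrite mulrA.
Qed.
HB.instance Definition _ := GRing.Lalgebra_isAlgebra.Build CC superalg scaleSAr.

Lemma mon_cat u v : mon (u ++ v) = mon u * mon v.
Proof. by rewrite -cls_mul /scmul /= mul1r. Qed.

Definition gen (x : X) : superalg := mon [:: x].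

Lemma mon_cons x w : mon (x :: w) = gen x * mon w.
Proof. by rewrite -mon_cat. Qed.

Lemma mon_nil : mon [::] = 1. Proof. by []. Qed.

Lemma cls_cst c : cls (sccst X c) = c%:A.
Proof. by rewrite cls_sum big_seq1. Qed.

Lemma mon_swap : swapok mon.
Proof.
move=> u x y v; apply: coefS_inj => m; rewrite coefSZ !coefS_cls !coefE !big_seq1.
by rewrite !mul1r [wcoefw _ _]wcoefw_swap.
Qed.

Lemma gen_swap x y : gen x * gen y = sgn (par x && par y) *: (gen y * gen x).
Proof. by rewrite -!mon_cat; apply: (mon_swap [::]). Qed.

Lemma mon_ind (P : superalg -> Prop) :
  P 0 -> (forall s t, P s -> P t -> P (s + t)) ->
  (forall c w, P (c *: mon w)) -> forall s, P s.
Proof.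
move=> P0 PD PM; elim/cls_ind=> p; rewrite cls_sum.
by elim/big_ind: _ => // i _; apply: PM.
Qed.

Lemma lin_mon_eq (M : lmodType CC) (f g : {linear superalg -> M}) :
  (forall w, f (mon w) = g (mon w)) -> f =1 g.
Proof.
move=> h; elim/mon_ind => [|s t fs ft|c w]; first by rewrite !linear0.
- by rewrite !linearD fs ft.
- by rewrite !linearZ h.
Qed.

(** The linear extension to the quotient of a function on words; by [swapok_sceq] the chosen
    representative does not matter. The homomorphisms and derivations on the superalgebra are all
    obtained from it. *)
Definition lin (M : lmodType CC) (F : seq X -> M) (ok : swapok F) (s : superalg) : M :=
  \sum_(t <- repr s) t.1 *: F t.2.

Lemma lin_cls (M : lmodType CC) (F : seq X -> M) (ok : swapok F) p :
  lin ok (cls p) = \sum_(t <- p) t.1 *: F t.2.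
Proof. exact/swapok_sceq/reprP. Qed.

Lemma lin_linear (M : lmodType CC) (F : seq X -> M) (ok : swapok F) :
  linear (lin ok).
Proof.
move=> c; elim/cls_ind=> p; elim/cls_ind=> q.
rewrite -cls_scale -cls_add !lin_cls big_cat big_map scaler_sumr /=.
by congr (_ + _); apply: eq_bigr => t _; rewrite scalerA.
Qed.

HB.instance Definition _ (M : lmodType CC) (F : seq X -> M) (ok : swapok F) :=
  GRing.isLinear.Build CC superalg M *:%R (lin ok) (lin_linear ok).

Lemma lin_mon (M : lmodType CC) (F : seq X -> M) (ok : swapok F) w :
  lin ok (mon w) = F w.
Proof. by rewrite lin_cls big_seq1 scale1r. Qed.

Lemma coefS_expand s : exists2 L : seq (seq X), uniq L &
  s = \sum_(m <- L) coefS s m *: mon m.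
Proof.
elim/cls_ind: s => p.
pose nf (t : CC * seq X) := if normw par t.2 is Some (b, s) then s else [::].
exists (undup (map nf p)); first exact: undup_uniq.
under eq_bigr do rewrite coefS_cls.
rewrite cls_sum (swapok_coef (mon_swap) (undup_uniq (map nf p))) // => t b s tp E.
by rewrite mem_undup; apply/mapP; exists t => //; rewrite /nf E.
Qed.

End Normalization.

(** * Homomorphisms and superderivations *)

Section SuperMaps.
Variables (X : countType) (par : X -> bool).
Local Notation S := (superalg par).
Local Notation gen := (gen par).
Local Notation mon := (mon par).

Lemma wpar_cat u v : wpar par (u ++ v) = wpar par u (+) wpar par v.
Proof. by elim: u => //= x u ->; rewrite addbA. Qed.

Lemma sg_swapok b : swapok par (fun w => sgn (b && wpar par w) *: mon w).
Proof.
move=> u x y v; rewrite mon_swap !scalerA; congr (_ *: _); rewrite mulrC.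
by rewrite !wpar_cat /= (addbCA (par x)).
Qed.

(* [sg true] is the parity automorphism and [sg false] the identity, so that the sign rule
   for a map of parity t past u is multiplication by [sg t u]. *)
Definition sg b : S -> S := lin (sg_swapok b).
HB.instance Definition _ b := GRing.Linear.copy (sg b) (lin (sg_swapok b)).

Lemma sg_mon b w : sg b (mon w) = sgn (b && wpar par w) *: mon w.
Proof. exact: lin_mon. Qed.

Lemma sg_gen b x : sg b (gen x) = sgn (b && par x) *: gen x.
Proof. by rewrite sg_mon /= addbF. Qed.

Lemma sg1 b : sg b 1 = 1.
Proof. by rewrite -mon_nil sg_mon andbF scale1r. Qed.

Lemma sg_false s : sg false s = s.
Proof.
by apply: (lin_mon_eq (f := sg false) (g := idfun)) => w /=; rewrite sg_mon scale1r.
Qed.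

Lemma sgM b s t : sg b (s * t) = sg b s * sg b t.
Proof.
elim/mon_ind: s => [|s s' IH IH'|c u]; first by rewrite mul0r linear0 mul0r.
  by rewrite mulrDl !linearD /= mulrDl IH IH'.
elim/mon_ind: t => [|s s' IH IH'|d v]; first by rewrite mulr0 linear0 mulr0.
  by rewrite mulrDr !linearD /= mulrDr IH IH'.
rewrite -scalerAl -scalerAr !linearZ /= -mon_cat !sg_mon.
rewrite -!(scalerAl, scalerAr) -mon_cat !scalerA wpar_cat.
congr (_ *: _); rewrite andb_addr sgnD; by rewrite -!mulrA; congr (_ * _); rewrite mulrCA.
Qed.

Lemma sg_sg b c s : sg b (sg c s) = sg (b (+) c) s.
Proof.
apply: (lin_mon_eq (f := sg b \o sg c) (g := sg (b (+) c))) => w /=.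
by rewrite sg_mon linearZ /= !sg_mon scalerA andb_addl sgnD mulrC.
Qed.

Lemma gen_comm x s : gen x * s = sg (par x) s * gen x.
Proof.
elim/mon_ind: s => [|s s' IH IH'|c u]; first by rewrite mulr0 linear0 mul0r.
  by rewrite mulrDr linearD /= mulrDl IH IH'.
rewrite -scalerAr linearZ /= -scalerAl; congr (_ *: _).
elim: u => [|y u IH] /=; first by rewrite mon_nil mulr1 sg1 mul1r.
rewrite mon_cons mulrA gen_swap -scalerAl -mulrA IH sgM sg_gen.
by rewrite -!scalerAl !mulrA.
Qed.

(** Homogeneity as an eigenvector condition for the parity automorphism, so that 0 is homogeneous of
    both parities. *)
Definition homog b (s : S) := sg true s = sgn b *: s.

Lemma homog_sg b s c : homog b s -> sg c s = sgn (c && b) *: s.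
Proof. by case: c => // _; rewrite sg_false scale1r. Qed.

Lemma homog_gen x : homog (par x) (gen x).
Proof. by rewrite /homog sg_gen. Qed.

Lemma homog0 b : homog b 0. Proof. by rewrite /homog linear0 scaler0. Qed.
Lemma homogD b s t : homog b s -> homog b t -> homog b (s + t).
Proof. by rewrite /homog => hs ht; rewrite linearD /= hs ht scalerDr. Qed.
Lemma homogZ b c s : homog b s -> homog b (c *: s).
Proof. by rewrite /homog => hs; rewrite linearZ /= hs !scalerA mulrC. Qed.
Lemma homog1 : homog false 1.
Proof. by rewrite /homog sg1 scale1r. Qed.
Lemma mon_prod w : mon w = \prod_(x <- w) gen x.
Proof. by elim: w => [|x w IH]; rewrite ?big_nil // big_cons mon_cons IH. Qed.

Section AlgebraMorphism.
Variables (A : algType CC) (phi : X -> A).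

Definition supercomm :=
  forall x y, phi x * phi y = sgn (par x && par y) *: (phi y * phi x).
Hypothesis phiC : supercomm.

Lemma ahom_swapok : swapok par (fun w => \prod_(x <- w) phi x).
Proof.
move=> u x y v; rewrite !big_cat !big_cons /= !mulrA.
by rewrite -(mulrA _ (phi x)) phiC -scalerAr -scalerAl !mulrA.
Qed.

(** The universal property of the free supercommutative algebra. *)
Definition ahom : S -> A := lin ahom_swapok.
HB.instance Definition _ := GRing.Linear.copy ahom (lin ahom_swapok).

Lemma ahom_mon w : ahom (mon w) = \prod_(x <- w) phi x.
Proof. exact: lin_mon. Qed.
Lemma ahom_gen x : ahom (gen x) = phi x.
Proof. by rewrite ahom_mon big_seq1. Qed.

Lemma ahom_monoid : monoid_morphism ahom.
Proof.
split=> [|s t]; first by rewrite -mon_nil ahom_mon big_nil.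
elim/mon_ind: s => [|s s' IH IH'|c u]; first by rewrite mul0r linear0 mul0r.
  by rewrite mulrDl !linearD /= mulrDl IH IH'.
elim/mon_ind: t => [|s s' IH IH'|d v]; first by rewrite mulr0 linear0 mulr0.
  by rewrite mulrDr !linearD /= mulrDr IH IH'.
rewrite -scalerAl -scalerAr !linearZ /= -mon_cat !ahom_mon big_cat.
by rewrite -scalerAl -scalerAr.
Qed.
HB.instance Definition _ := GRing.isMonoidMorphism.Build S A ahom ahom_monoid.

End AlgebraMorphism.

Section Derivation.
Variables (t : bool) (d : X -> S).

Fixpoint derw (w : seq X) : S :=
  if w is x :: w' then d x * mon w' + sgn (t && par x) *: (gen x * derw w') else 0.

Definition derok := forall x, homog (par x (+) t) (d x).
Hypothesis dok : derok.

(** The terms that differentiate [x] and [y] are exchanged by commuting one generator past the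
    derivative of the other; the homogeneity of [d] supplies the sign. *)
Lemma derw_swapok : swapok par derw.
Proof.
move=> u x y v; elim: u => [|z u IH] /=.
  have hx := gen_comm x (d y); have hy := gen_comm y (d x).
  rewrite (homog_sg _ (dok _)) -scalerAl in hx.
  rewrite (homog_sg _ (dok _)) -scalerAl in hy.
  rewrite !mon_cons !mulrDr !scalerDr -!scalerAr !mulrA hx hy gen_swap.
  rewrite -!(scalerAl, scalerAr) !scalerA addrCA !addrA -!mulrA.
  congr (_ *: _ + _ + _ *: _).
  - case: (par x); case: (par y); case: t => /=;
      by rewrite /sgn /= ?(mulr1, mul1r, mulrNN, mulN1r, mulrN1, opprK).
  - rewrite -[LHS]scale1r; congr (_ *: _);
    case: (par x); case: (par y); case: t => /=;
      by rewrite /sgn /= ?(mulr1, mul1r, mulrNN, mulN1r, mulrN1, opprK).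
  - case: (par x); case: (par y); case: t => /=;
      by rewrite /sgn /= ?(mulr1, mul1r, mulrNN, mulN1r, mulrN1, opprK).
rewrite IH mon_swap scalerDr -!scalerAr !scalerA.
by congr (_ + _ *: _); rewrite mulrC.
Qed.

Definition der : S -> S := lin derw_swapok.
HB.instance Definition _ := GRing.Linear.copy der (lin derw_swapok).

Lemma der_mon w : der (mon w) = derw w.
Proof. exact: lin_mon. Qed.
Lemma der_gen x : der (gen x) = d x.
Proof. by rewrite der_mon /= mulr0 scaler0 addr0 mon_nil mulr1. Qed.
Lemma der1 : der 1 = 0.
Proof. by rewrite -mon_nil der_mon. Qed.

Lemma derM u v : der (u * v) = der u * v + sg t u * der v.
Proof.
elim/mon_ind: u => [|s s' IH IH'|c u].
- by rewrite mul0r !linear0 !mul0r addr0.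
- by rewrite mulrDl !linearD /= !mulrDl IH IH' addrACA.
elim/mon_ind: v => [|s s' IH IH'|e v].
- by rewrite mulr0 !linear0 !mulr0 addr0.
- by rewrite mulrDr !linearD /= !mulrDr IH IH' addrACA.
rewrite -scalerAl -scalerAr !linearZ /= -!(scalerAl, scalerAr) -!scalerDr.
rewrite -mon_cat !der_mon sg_mon -scalerAl.
congr (_ *: (_ *: _)).
elim: u => [|x u IH] /=; first by rewrite mul0r add0r andbF scale1r mon_nil mul1r.
rewrite IH mulrDl mon_cat -!(scalerAl, scalerAr) mulrDr scalerDr -addrA !mulrA.
rewrite mon_cons; congr (_ + (_ + _)).
by rewrite -!(scalerAl, scalerAr) scalerA mulrA andb_addr sgnD.
Qed.

Lemma der_sg b s : der (sg b s) = sgn (b && t) *: sg b (der s).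
Proof.
apply: (lin_mon_eq (f := der \o sg b) (g := sgn (b && t) \*: sg b \o der)) => w /=.
rewrite sg_mon linearZ /= der_mon.
suff -> : sg b (derw w) = sgn (b && (wpar par w (+) t)) *: derw w.
  by rewrite scalerA -sgnD -andb_addr addbC -addbA addbb addbF.
elim: w => [|x w IH] /=; first by rewrite linear0 scaler0.
rewrite linearD linearZ /= !sgM IH (homog_sg _ (dok x)) sg_mon sg_gen.
rewrite scalerDr -!(scalerAl, scalerAr) !scalerA -!sgnD.
by clear; congr (sgn _ *: _ + sgn _ *: _); case: b; case: t; case: (par x);
   case: (wpar par w).
Qed.

End Derivation.
End SuperMaps.

(** * From list representatives to classes *)

Section ListOperations.
Variables (X : countType) (par : X -> bool).
Local Notation cls := (cls par).

Lemma cls_cat p q : cls (p ++ q) = cls p + cls q.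
Proof. exact: cls_add. Qed.

Lemma cls_flatten ps : cls (flatten ps) = \sum_(p <- ps) cls p.
Proof. by elim: ps => [|p ps IH]; rewrite ?big_nil // big_cons -IH -cls_cat. Qed.

Lemma cls_opp p : cls (scopp p) = - cls p.
Proof. by rewrite cls_scale scaleN1r. Qed.

Lemma cls_scsgn p : cls (scsgn par p) = sg true (cls p).
Proof.
rewrite !cls_sum linear_sum big_map; apply: eq_bigr => t _ /=.
by rewrite linearZ /= sg_mon scalerA mulrC.
Qed.

Lemma nth_mkseq_default (T : Type) (x0 : T) f m k :
  nth x0 (mkseq f m) k = if (k < m)%N then f k else x0.
Proof.
by case: ltnP => h; [rewrite nth_mkseq|rewrite nth_default // size_mkseq].
Qed.

(** The default [[::]] represents 0, so the equation also holds beyond the length of the lists. *)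
Lemma cls_vdadd (p q : seq (sc X)) k :
  cls (nth [::] (mkseq (fun k => scadd (nth [::] p k) (nth [::] q k))
    (maxn (size p) (size q))) k) = cls (nth [::] p k) + cls (nth [::] q k).
Proof.
rewrite nth_mkseq_default; case: ifP => [_|/negbT]; first exact: cls_add.
rewrite -leqNgt geq_max => /andP[hp hq].
by rewrite !nth_default // addr0.
Qed.

Lemma cls_nth_map (f : sc X -> sc X) (g : superalg par -> superalg par) p k :
  f [::] = [::] -> (forall v, cls (f v) = g (cls v)) ->
  cls (nth [::] (map f p) k) = g (cls (nth [::] p k)).
Proof.
move=> f0 fg; case: (ltnP k (size p)) => h; first by rewrite (nth_map [::]).
by rewrite !nth_default ?size_map // -fg f0.
Qed.

End ListOperations.

(** * The odd derivation given by a shift of the generators *)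

Section Differential.
Variables (X : countType) (par : X -> bool) (sh : X -> X).
Hypothesis par_sh : forall x, par (sh x) = ~~ par x.

Lemma shift_derok : derok true (fun x => gen par (sh x)).
Proof. by move=> x; rewrite addbT -par_sh; apply: homog_gen. Qed.

Definition dif : superalg par -> superalg par := der shift_derok.
HB.instance Definition _ := GRing.Linear.copy dif (der shift_derok).

Lemma dif_gen x : dif (gen par x) = gen par (sh x).
Proof. exact: der_gen. Qed.
Lemma difM u v : dif (u * v) = dif u * v + sg true u * dif v.
Proof. exact: derM. Qed.
Lemma dif1 : dif 1 = 0. Proof. exact: der1. Qed.
Lemma dif_cst c : dif c%:A = 0. Proof. by rewrite linearZ /= dif1 scaler0. Qed.
Lemma dif_sg b s : dif (sg b s) = sgn b *: sg b (dif s).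
Proof. by rewrite /dif der_sg andbT. Qed.
Lemma homog_dif b s : homog b s -> homog (~~ b) (dif s).
Proof.
rewrite /homog => h; have := dif_sg true s; rewrite h linearZ /= => e.
by rewrite sgnN scaleNr e /sgn scaleN1r opprK.
Qed.

End Differential.

(** * The coefficients of the chi-bracket *)

Section Brackets.
Variable n : nat.
Local Notation S := (superalg (@parG n)).
Local Notation cls := (cls (@parG n)).
Local Notation gen := (gen (@parG n)).
Local Notation mon := (mon (@parG n)).

Lemma parG_Dg (g : Gen n) : parG (Dg g) = ~~ parG g.
Proof. by rewrite /parG /= negbK; case: odd; rewrite ?addbT ?addbF ?negbK. Qed.

Definition D := dif parG_Dg.
HB.instance Definition _ := GRing.Linear.copy D (dif parG_Dg).

Lemma D_gen c d l : D (gen (c, d, l)) = gen (c, d, l.+1).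
Proof. exact: dif_gen. Qed.

Lemma DM u v : D (u * v) = D u * v + sg true u * D v.
Proof. exact: difM. Qed.

Lemma Dcst c : D c%:A = 0.
Proof. exact: dif_cst. Qed.

Lemma D1 : D 1 = 0.
Proof. exact: dif1. Qed.

Lemma cls_Dw w : \sum_(b <- Dw w) sgn b.1 *: mon b.2 = D (mon w).
Proof.
rewrite /D/dif der_mon; elim: w => [|x w IH] /=; first by rewrite big_nil.
rewrite big_cons /= scale1r -IH big_map mon_cons; congr (_ + _).
rewrite mulr_sumr scaler_sumr; apply: eq_bigr => b _ /=.
by rewrite mon_cons sgnD -scalerAr scalerA.
Qed.

Lemma cls_DV p : cls (DV p) = D (cls p).
Proof.
rewrite cls_flatten big_map cls_sum linear_sum; apply: eq_bigr => t _ /=.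
rewrite linearZ /= -cls_Dw cls_sum big_map scaler_sumr; apply: eq_bigr => b _ /=.
by rewrite scalerA mulrC.
Qed.

Definition bar (A : 'M[CC]_(N n)) : S := \sum_i \sum_j A i j *: gen (i, j, 0%N).

Lemma cls_barV A : cls (barV A) = bar A.
Proof.
rewrite cls_sum /barV big_allpairs_dep /bar big_enum /=.
by apply: eq_bigr => i _; rewrite big_enum.
Qed.

Lemma bar_linear : linear bar.
Proof.
move=> c A B; rewrite /bar scaler_sumr -big_split; apply: eq_bigr => i _ /=.
rewrite scaler_sumr -big_split; apply: eq_bigr => j _ /=.
by rewrite !mxE scalerDl scalerA.
Qed.
HB.instance Definition _ := GRing.isLinear.Build CC 'M[CC]_(N n) S *:%R bar bar_linear.

Lemma bar_delta i j : bar (delta_mx i j) = gen (i, j, 0%N).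
Proof.
rewrite /bar (bigD1 i) //= (bigD1 j) //= !mxE !eqxx scale1r.
rewrite big1 => [|k /negbTE nk]; last by rewrite !mxE nk andbF scale0r.
rewrite big1 => [|k /negbTE nk]; rewrite ?addr0 //.
by rewrite big1 // => l _; rewrite !mxE nk scale0r.
Qed.

Lemma form_delta (a b c d : Idx n) :
  form (delta_mx a b) (delta_mx c d) = if (b == c) && (a == d) then sgn (pI a) else 0.
Proof.
rewrite /form /str; case: (eqVneq b c) => [<-|bc].
  rewrite mul_delta_mx (bigD1 a) //= mxE eqxx /=.
  rewrite big1 => [|k /negbTE nk]; last by rewrite mxE nk mulr0.
  by rewrite addr0; case: eqP => _; rewrite ?mulr1 ?mulr0.
by rewrite mul_delta_mx_0 // big1 // => k _; rewrite mxE mulr0.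
Qed.

Lemma form_f_delta (i j : Idx n) :
  form (fmat n) (delta_mx i j) = if j == i.+1 :> nat then sgn (pI j) else 0.
Proof.
rewrite /form /str (bigD1 j) //= mxE (bigD1 i) //= !mxE !eqxx /=.
rewrite big1 => [|k /negbTE nk]; last by rewrite !mxE nk mulr0.
rewrite big1 => [|k /negbTE nk]; last first.
  rewrite mxE big1 ?mulr0 // => l _; by rewrite !mxE nk andbF mulr0.
by rewrite !addr0 mulr1; case: eqP; rewrite ?mulr1 ?mulr0.
Qed.

Lemma form_f_linear : linear (form (fmat n) : _ -> CC^o).
Proof.
move=> c A B; rewrite /form /str scaler_sumr -big_split; apply: eq_bigr => i _.
rewrite mulmxDr -scalemxAr !mxE mulrDr; congr (_ + _); exact: mulrCA.
Qed.
HB.instance Definition _ := GRing.isLinear.Build CC 'M[CC]_(N n) CC^o *:%R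
  (form (fmat n)) form_f_linear.

(** The coefficient sequence of chi times the polynomial in chi with coefficients [f]. *)
Definition prv (f : nat -> S) (k : nat) : S := if k is k'.+1 then f k' else 0.

Lemma cls_vxadd p q k :
  cls (nth [::] (vxadd p q) k) = cls (nth [::] p k) + cls (nth [::] q k).
Proof. exact: cls_vdadd. Qed.

Lemma cls_vxscale c p k : cls (nth [::] (vxscale c p) k) = c *: cls (nth [::] p k).
Proof. by apply: (@cls_nth_map _ _ (scscale c) ( *:%R c)) => // v; exact: cls_scale. Qed.

Lemma cls_foldr_vxadd ps k :
  cls (nth [::] (foldr (@vxadd n) [::] ps) k) = \sum_(p <- ps) cls (nth [::] p k).
Proof.
elim: ps => [|p ps IH] /=; first by rewrite big_nil nth_nil.
by rewrite cls_vxadd IH big_cons.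
Qed.

(** From [D chi + chi D = -2 chi^2], D commutes with even powers of chi, while on an odd power it
    changes sign and contributes -2 to the next even coefficient. There the -2 turns the +1 of chi
    into -1, so that one formula serves both parities of k. *)
Lemma cls_vxDchi p k : cls (nth [::] (vxadd (vxD p) (vxchi p)) k) =
  sgn (odd k) *: (D (cls (nth [::] p k)) - prv (fun k => cls (nth [::] p k)) k).
Proof.
rewrite cls_vxadd /vxD nth_mkseq_default.
have -> : cls (nth [::] (vxchi p) k) = prv (fun k => cls (nth [::] p k)) k.
  by case: k.
have -> : cls (if (k < (size p).+1)%N
        then scadd
          (if odd k then scopp (DV (nth [::] p k)) else DV (nth [::] p k))
          (if odd k then [::]
           else if k is k'.+1 then scscale (-2) (nth [::] p k') else [::])
        else [::]) =
    sgn (odd k) *: D (cls (nth [::] p k)) +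
    (if odd k then 0 else -2 *: prv (fun k => cls (nth [::] p k)) k).
  case: ifP => [_|/negbT].
    rewrite cls_add; case: (odd k); rewrite ?cls_opp cls_DV ?scaleN1r ?scale1r //.
    by congr (_ + _); case: k => [|k] /=; rewrite ?scaler0 ?cls_scale.
  rewrite -leqNgt => h; rewrite nth_default; last exact: ltnW.
  rewrite linear0 scaler0 add0r; case: (odd k) => //.
  by case: k h => [|k] h /=; rewrite ?nth_default ?scaler0.
case: (odd k); rewrite /sgn ?addr0 ?scaleN1r ?scale1r ?opprB 1?addrC //.
have e : 1 - 2 = -1 :> CC by rewrite -opprB -[2]/(1 + 1) addrK.
by rewrite addrCA -{1}[prv _ _]scale1r -scalerDl e scaleN1r.
Qed.

Section Bracket.
Variables a b : Idx n.
Let s := pI a (+) pI b.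

Definition dgen (k : nat) (g : Gen n) : S := cls (nth [::] (brgen a b g) k).

Lemma dgenS k c d l : dgen k (c, d, l.+1) =
  sgn (s (+) odd k) *: (D (dgen k (c, d, l)) - prv (dgen^~ (c, d, l)) k).
Proof.
rewrite {1}/dgen /brgen iterS cls_vxscale cls_vxDchi scalerA -sgnD.
by congr (_ *: (_ - _)); case: k.
Qed.

Lemma dgen0 k c d : dgen k (c, d, 0%N) =
  match k with
  | 0 => sgn (s && ~~ (pI c (+) pI d)) *: bar (sbr a b c d)
  | 1 => (form (delta_mx a b) (delta_mx c d))%:A
  | _ => 0
  end.
Proof.
case: k => [|[|k]]; rewrite /dgen /brgen /= ?nth_nil //.
- by rewrite cls_scale cls_barV.
- by rewrite cls_cst.
Qed.

Lemma bar_sbr c d : bar (sbr a b c d) =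
  (if b == c then gen (a, d, 0%N) else 0)
  - sgn (s && (pI c (+) pI d)) *: (if a == d then gen (c, b, 0%N) else 0).
Proof.
rewrite /sbr linearB linearZ /=.
by congr (_ - _ *: _); case: ifP => _; rewrite ?linear0 ?bar_delta.
Qed.

(** Induction on the number of derivatives: D and the shift in chi each change the parity by one.
    Without derivatives the constant at chi occurs only for [(c, d) = (b, a)], which has the parity
    of e_ab. *)
Lemma dgen_derok k : derok (s (+) odd k) (dgen k).
Proof.
case=> [[c d] l]; elim: l k => [|l IH] k; last first.
  have -> : (c, d, l.+1) = Dg (c, d, l) by [].
  rewrite parG_Dg /Dg /= dgenS; apply/homogZ/homogD.
    by rewrite addNb; apply: homog_dif.
  case: k => [|k] /=; first by rewrite oppr0; apply: homog0.
  rewrite -scaleN1r; apply: homogZ; have := IH k.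
  by congr (homog _ _); case: parG; case: s; case: odd.
rewrite dgen0 {2}/parG /=; case: k => [|[|k]] /=; last exact: homog0.
- apply: homogZ; rewrite bar_sbr -scaleNr; apply: homogD; last apply: homogZ.
  + case: eqP => [<-|_]; last exact: homog0.
    have := homog_gen (@parG n) (a, d, 0%N); rewrite /parG /= /s.
    by congr (homog _ _); case: (pI a); case: (pI b); case: (pI d).
  + case: eqP => [<-|_]; last exact: homog0.
    have := homog_gen (@parG n) (c, b, 0%N); rewrite /parG /= /s.
    by congr (homog _ _); case: (pI a); case: (pI b); case: (pI c).
- rewrite form_delta; case: andP => [[/eqP <- /eqP <-]|_]; last first.
    by rewrite scale0r; apply: homog0.
  apply: homogZ; have := homog1 (@parG n).
  by congr (homog _ _); rewrite /s; case: (pI a); case: (pI b).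
Qed.

Definition del k := der (dgen_derok k).
HB.instance Definition _ k := GRing.Linear.copy (del k) (der (dgen_derok k)).

Lemma del_gen k g : del k (gen g) = dgen k g.
Proof. exact: der_gen. Qed.
Lemma delM k u v : del k (u * v) = del k u * v + sg (s (+) odd k) u * del k v.
Proof. exact: derM. Qed.
Lemma del1 k : del k 1 = 0. Proof. exact: der1. Qed.
Lemma del_sg k c u : del k (sg c u) = sgn (c && (s (+) odd k)) *: sg c (del k u).
Proof. exact: der_sg. Qed.

(** Moving y past chi^k costs [(-1)^(k p(y))], which turns the sign in the Leibniz rule of the
    bracket into that of a derivation of parity s + k. *)
Lemma cls_brw w k : cls (nth [::] (brw a b w) k) = del k (mon w).
Proof.
rewrite /del der_mon; elim: w k => [|x w IH] k /=; first by rewrite nth_nil.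
rewrite cls_vxadd cls_vxscale addrC; congr (_ + _).
  rewrite (@cls_nth_map _ _ (fun v => scmul v [:: (1, w)]) ( *%R^~ (mon w))) //.
  by move=> v; rewrite cls_mul.
rewrite [in RHS]andb_addl sgnD -scalerA; congr (_ *: _).
rewrite -IH /vxlmul nth_mkseq_default andbC; case: ltnP => h.
  by case: ifP => _; rewrite cls_mul ?cls_opp /sgn ?mulNr ?scaleN1r ?scale1r.
by rewrite nth_default // [cls [::] in RHS](_ : _ = 0) // mulr0 scaler0.
Qed.

Lemma cls_brV v k : cls (nth [::] (brV a b v) k) = del k (cls v).
Proof.
rewrite cls_foldr_vxadd big_map cls_sum linear_sum; apply: eq_bigr => t _ /=.
by rewrite cls_vxscale cls_brw linearZ.
Qed.

(** Sesquilinearity holds on generators by construction and passes to products through the Leibniz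
    rules of [D] and [del]. *)
Lemma delD_mon w k : del k (D (mon w)) =
  sgn (s (+) odd k) *: (D (del k (mon w)) - prv (del^~ (mon w)) k).
Proof.
elim: w k => [|x w IH] k.
  by rewrite mon_nil D1 del1 !linear0; case: k => [|k] /=;
     rewrite ?del1 subr0 scaler0.
have hx := dgen_derok k x; rewrite /homog in hx.
rewrite mon_cons DM linearD /= !delM [D (_ + _)]linearD /= !DM.
rewrite !del_sg !del_gen hx sg_sg !sg_gen IH.
have -> : D (gen x) = gen (Dg x) by exact: dif_gen.
rewrite del_gen !sg_gen parG_Dg.
have -> : dgen k (Dg x) = sgn (s (+) odd k) *: (D (dgen k x) - prv (dgen^~ x) k).
  by case: x {IH hx} => [[c d] l]; rewrite dgenS.
rewrite [D (_ *: gen x)]linearZ /=.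
have -> : D (gen x) = gen (Dg x) by exact: dif_gen.
have -> : prv (del^~ (gen x * mon w)) k = prv (dgen^~ x) k * mon w +
    sgn ((s (+) ~~ odd k) && parG x) *: (gen x * prv (del^~ (mon w)) k).
  case: k {IH hx} => [|k] /=; first by rewrite mul0r mulr0 scaler0 addr0.
  by rewrite delM del_gen sg_gen negbK -scalerAl.
set p1 := prv _ k; set p2 := prv _ k.
(* Each side expands into six terms; after a reordering they agree one by one, up to a finite check
   of the sign exponents. *)
rewrite !(mulrBl, mulrBr, scalerBr, scalerDr, mulrDl, mulrDr, opprD).
rewrite -!(scalerAl, scalerAr, scalerN) !scalerA -!sgnD.
rewrite [sg true (_ *: _)]linearZ /= sg_gen -!scalerAl !scalerA -!sgnD !addrA.
rewrite [RHS](ACl (1 * 5 * 3 * 2 * 4 * 6)%AC) /=.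
by congr (_ + _ + sgn _ *: _ + _ + sgn _ *: _ + (sgn _ * _) *: _);
   clear; case: s; case: (odd k); case: (parG x).
Qed.

Lemma delD k u :
  del k (D u) = sgn (s (+) odd k) *: (D (del k u) - prv (del^~ u) k).
Proof.
case: k => [|k] /=.
  rewrite subr0; apply: (lin_mon_eq (f := del 0 \o D)
    (g := sgn (s (+) false) \*: (D \o del 0))) => w /=.
  by rewrite delD_mon subr0.
apply: (lin_mon_eq (f := del k.+1 \o D)
  (g := sgn (s (+) ~~ odd k) \*: (D \o del k.+1 \- del k))) => w /=.
by rewrite delD_mon.
Qed.

End Bracket.

Lemma cls_brA A v k : cls (nth [::] (brA A v) k) =
  \sum_i \sum_j A i j *: del i j k (cls v).
Proof.
rewrite cls_foldr_vxadd big_allpairs_dep big_enum; apply: eq_bigr => i _ /=.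
by rewrite big_enum; apply: eq_bigr => j _ /=; rewrite cls_vxscale cls_brV.
Qed.

End Brackets.

(** * Supports, and reduction modulo J *)

Section Support.
Variables (X : countType) (par : X -> bool).
Local Notation S := (superalg par).
Local Notation mon := (mon par).

Lemma ins_perm x s b t : ins par x s = Some (b, t) -> perm_eq t (x :: s).
Proof.
elim: s b t => [|y s IH] b t /=; first by case=> _ <-.
case: ifP => _; first by case=> _ <-.
case: eqP => [<-|_]; first by case: (par x) => // -[_ <-].
case E: (ins par x s) => [[c u]|] // [_ <-].
by rewrite -[x :: y :: s]/([:: x] ++ [:: y] ++ s) perm_sym perm_catCA /= perm_cons
   perm_sym (IH _ _ E).
Qed.

Lemma normw_perm w b s : normw par w = Some (b, s) -> perm_eq s w.
Proof.
elim: w b s => [|x w IH] b s /=; first by case=> _ <-.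
case E: (normw par w) => [[c u]|] //; case F: (ins par x u) => [[d v]|] // [_ <-].
by apply: perm_trans (ins_perm F) _; rewrite perm_cons (IH _ _ E).
Qed.

Lemma coefS_mon w m : coefS (mon w) m = wcoefw par w m.
Proof. by rewrite coefS_cls coefE big_seq1 mul1r. Qed.

Lemma coefS_mon_perm w m : coefS (mon w) m != 0 -> perm_eq m w.
Proof.
rewrite coefS_mon /wcoefw; case E: (normw par w) => [[b s]|]; last by rewrite eqxx.
by case: (s =P m) => [<- _|_]; [exact: normw_perm E|rewrite eqxx].
Qed.

(** Applied to permutation-invariant [Q], for which the condition may be tested on a word that is
    not in normal form. *)
Definition suppin (Q : seq X -> bool) (s : S) := forall m, coefS s m != 0 -> Q m.
Definition perm_inv (Q : seq X -> bool) := forall u v, perm_eq u v -> Q u = Q v.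

Lemma suppin0 Q : suppin Q 0.
Proof. by move=> m; rewrite coefS0 eqxx. Qed.
Lemma suppinD Q s t : suppin Q s -> suppin Q t -> suppin Q (s + t).
Proof.
move=> hs ht m; rewrite coefSD; case: (eqVneq (coefS s m) 0) => [->|/hs //].
by rewrite add0r => /ht.
Qed.
Lemma suppinZ Q c s : suppin Q s -> suppin Q (c *: s).
Proof. by move=> hs m; rewrite coefSZ mulf_eq0 negb_or => /andP[_ /hs]. Qed.
Lemma suppinN Q s : suppin Q s -> suppin Q (- s).
Proof. by rewrite -scaleN1r; apply: suppinZ. Qed.
Lemma suppinW (Q Q' : seq X -> bool) s :
  (forall m, Q m -> Q' m) -> suppin Q s -> suppin Q' s.
Proof. by move=> h hs m /hs /h. Qed.
Lemma suppin_mon Q w : perm_inv Q -> Q w -> suppin Q (mon w).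
Proof. by move=> hQ Qw m /coefS_mon_perm /hQ ->. Qed.

Lemma suppin_ind (Q : seq X -> bool) (P : S -> Prop) :
  P 0 -> (forall s t, P s -> P t -> P (s + t)) ->
  (forall c w, Q w -> P (c *: mon w)) -> forall s, suppin Q s -> P s.
Proof.
move=> P0 PD PM s hs; have [L _ ->] := coefS_expand s.
elim/big_ind: _ => // m _; case: (eqVneq (coefS s m) 0) => [->|/hs Qm].
  by rewrite scale0r.
exact: PM.
Qed.

Lemma suppinM (Q Q' Q'' : seq X -> bool) s t : perm_inv Q'' ->
  (forall u v, Q u -> Q' v -> Q'' (u ++ v)) ->
  suppin Q s -> suppin Q' t -> suppin Q'' (s * t).
Proof.
move=> pQ h; move: s; apply: suppin_ind => [_|s s' IH IH' ht|c u Qu].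
- by rewrite mul0r; apply: suppin0.
- by rewrite mulrDl; apply: suppinD; [apply: IH|apply: IH'].
move: t; apply: suppin_ind => [|s s' IH IH'|d v Qv].
- by rewrite mulr0; apply: suppin0.
- by rewrite mulrDr; apply: suppinD.
rewrite -scalerAl -scalerAr -mon_cat; do 2!apply: suppinZ.
by apply: suppin_mon => //; apply: h.
Qed.

End Support.

(** * Reduction modulo J, and W as the invariants in the quotient *)

Section ReductionModJ.
Variable n : nat.
Local Notation S := (superalg (@parG n)).
Local Notation cls := (cls (@parG n)).
Local Notation gen := (gen (@parG n)).
Local Notation mon := (mon (@parG n)).
Local Notation D := (@D n).

(** Modulo J a generator from n equals the constant (f|n), and its proper derivatives vanish as
    derivatives of a constant. *)
Definition phiR (g : Gen n) : S :=
  if isP g then gen g else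
  (if g.2 == 0%N then form (fmat n) (delta_mx g.1.1 g.1.2) else 0)%:A.

(** The form with f is nonzero only on the e_(i,i+1). These are odd, so the generators replaced by
    nonzero constants are even. *)
Lemma phiR_cst g : ~~ isP g -> exists2 c : CC, phiR g = c%:A & parG g -> c = 0.
Proof.
rewrite /phiR => /negbTE ->; eexists; first by [].
case: g => [[i j] [|l]] //=; rewrite form_f_delta /parG /= /pI.
by case: eqP => // ->; rewrite oddS; case: (odd i).
Qed.

Lemma phiR_homog g : homog (parG g) (phiR g).
Proof.
case Pg: (isP g); first by rewrite /phiR Pg; apply: homog_gen.
have [c -> hc] := phiR_cst (negbT Pg).
case: (parG g) hc => [-> //|_]; first by rewrite scale0r; apply: homog0.
exact/homogZ/homog1.
Qed.

Lemma phiR_comm : supercomm (@parG n) phiR.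
Proof.
have cst x y : ~~ isP x -> phiR x * phiR y = sgn (parG x && parG y) *: (phiR y * phiR x).
  move=> /phiR_cst[c -> hc]; rewrite -scalerAl -scalerAr mul1r mulr1 scalerA.
  by case: (parG x) hc => [->|_] //; rewrite ?mulr0 ?scale0r ?mul1r.
move=> x y; case Px: (isP x); last exact/cst/negbT.
case Py: (isP y); first by rewrite /phiR Px Py; apply: gen_swap.
by rewrite (cst y x (negbT Py)) scalerA andbC -sgnD addbb scale1r.
Qed.

Definition rho : S -> S := ahom phiR_comm.
HB.instance Definition _ := GRing.LRMorphism.copy rho (ahom phiR_comm).

Lemma rho_gen g : rho (gen g) = phiR g.
Proof. exact: ahom_gen. Qed.

Lemma rho_sg b s : rho (sg b s) = sg b (rho s).
Proof.
apply: (lin_mon_eq (f := rho \o sg b) (g := sg b \o rho)) => w /=.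
elim: w => [|x w IH]; first by rewrite mon_nil rmorph1 sg1 rmorph1.
rewrite mon_cons sgM !rmorphM /= sgM IH; congr (_ * _).
by rewrite sg_gen linearZ /= rho_gen (homog_sg _ (phiR_homog x)).
Qed.

Lemma phiR_D g : phiR (Dg g) = D (phiR g).
Proof.
rewrite /phiR /= -[isP (Dg g)]/(isP g); case: ifP => _; last first.
  by rewrite scale0r Dcst.
by case: g => [[c d] l]; rewrite D_gen.
Qed.

Lemma rho_D s : rho (D s) = D (rho s).
Proof.
apply: (lin_mon_eq (f := rho \o D) (g := D \o rho)) => w /=.
elim: w => [|x w IH]; first by rewrite mon_nil D1 rmorph1 D1 linear0.
rewrite mon_cons DM rmorphD !rmorphM /= DM IH rho_sg; congr (_ * _ + _).
by case: x {IH} => [[c d] l]; rewrite D_gen !rho_gen -phiR_D.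
Qed.

Lemma rho_mon w : all (@isP n) w -> rho (mon w) = mon w.
Proof.
elim: w => [|x w IH] /=; first by rewrite mon_nil rmorph1.
by case/andP=> Px /IH h; rewrite mon_cons rmorphM /= h rho_gen /phiR Px.
Qed.

Lemma all_perm_inv (p : pred (Gen n)) : perm_inv (all p).
Proof. by move=> u v h; apply: perm_all. Qed.

Lemma suppin_phiR g : suppin (all (@isP n)) (phiR g).
Proof.
rewrite /phiR; case: ifP => Pg.
  by apply: (suppin_mon (all_perm_inv _)); rewrite /= Pg.
by apply/suppinZ/(suppin_mon (w := [::]) (all_perm_inv _)).
Qed.

Lemma suppin_rho s : suppin (all (@isP n)) (rho s).
Proof.
elim/mon_ind: s => [|s t hs ht|c w]; first by rewrite linear0; apply: suppin0.
  by rewrite linearD; apply: suppinD.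
rewrite linearZ; apply: suppinZ => /=; elim: w => [|x w IH].
  by rewrite mon_nil rmorph1; apply: (suppin_mon (w := [::]) (all_perm_inv _)).
rewrite mon_cons rmorphM; rewrite /= rho_gen.
apply: suppinM (all_perm_inv _) _ (@suppin_phiR x) IH.
by move=> u v; rewrite all_cat => -> ->.
Qed.

Lemma rho_id s : (rho s = s) <-> suppin (all (@isP n)) s.
Proof.
split=> [<-|]; first exact: suppin_rho.
move: s; apply: suppin_ind => [|s t hs ht|c w hw]; first exact: linear0.
  by rewrite linearD /= hs ht.
by rewrite linearZ /= rho_mon.
Qed.

Lemma inVpP (x : V n) : inVp x <-> rho (cls x) = cls x.
Proof.
rewrite rho_id; split=> h m; rewrite ?coefS_cls => /eqP; first by move/h.
by move/eqP=> hm; apply: h; rewrite coefS_cls; apply/eqP.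
Qed.

Lemma inJ_ideal : isJideal (@inJ n).
Proof.
do !split.
- by move=> x y xy hx I hI; have [h _] := hI; apply: h xy (hx _ hI).
- by move=> I; case=> _ [].
- by move=> x y hx hy I hI; have [_ [_ [h _]]] := hI; apply: h (hx _ hI) (hy _ hI).
- by move=> x y hy I hI; have [_ [_ [_ [h _]]]] := hI; apply: h (hy _ hI).
- by move=> x y hx I hI; have [_ [_ [_ [_ [h _]]]]] := hI; apply: h (hx _ hI).
- by move=> x hx I hI; have [_ [_ [_ [_ [_ [h _]]]]]] := hI; apply: h (hx _ hI).
- by move=> A hA I [_ [_ [_ [_ [_ [_ h]]]]]]; apply: h.
Qed.

Lemma cls_barV_cst A :
  cls (scadd (barV A) (sccst (Gen n) (- form (fmat n) A))) =
  bar A - (form (fmat n) A)%:A.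
Proof. by rewrite cls_add cls_barV cls_cst scaleNr. Qed.

Lemma rho_bar A : in_n A -> rho (bar A) = (form (fmat n) A)%:A.
Proof.
move=> hA; have -> : form (fmat n) A = \sum_i \sum_j A i j * form (fmat n) (delta_mx i j).
  rewrite {1}(matrix_sum_delta A) linear_sum; apply: eq_bigr => i _ /=.
  by rewrite linear_sum; apply: eq_bigr => j _ /=; rewrite linearZ.
rewrite linear_sum scaler_suml; apply: eq_bigr => i _ /=.
rewrite linear_sum scaler_suml; apply: eq_bigr => j _ /=.
rewrite linearZ /= rho_gen /phiR /isP /=; case: leqP => ij.
  by rewrite hA -?leqNgt // mul0r !scale0r.
by rewrite scalerA.
Qed.

(** The kernel of [rho] is one of the ideals whose intersection is J. *)
Lemma inJ_rho (y : V n) : inJ y -> rho (cls y) = 0.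
Proof.
move=> hy; apply: (hy (fun y => rho (cls y) = 0)); do !split.
- by move=> u v /clsP ->.
- exact: linear0.
- by move=> u v hu hv; rewrite cls_add linearD /= hu hv addr0.
- by move=> u v hv; rewrite cls_mul rmorphM /= hv mulr0.
- by move=> u v hu; rewrite cls_mul rmorphM /= hu mul0r.
- by move=> u hu; rewrite cls_DV rho_D hu linear0.
- by move=> A hA; rewrite cls_barV_cst linearB /= rho_bar // linearZ /= rmorph1 subrr.
Qed.

(** On generators the difference is an iterated derivative of a defining relation of J; products
    follow from [xy - x'y' = (x - x')y + x'(y - y')]. Together with [inJ_rho] this identifies J with
    the kernel of [rho]. *)
Lemma sub_rho_inJ s y : cls y = s - rho s -> inJ y.
Proof.
have [hE [h0 [hD [hM [hM' [hDV hn]]]]]] := inJ_ideal.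
(* J as a predicate on classes: it asks for all representatives, which allows the argument to run in
   the quotient ring. *)
pose J (s : S) := forall y, cls y = s -> inJ y.
have JE u v : u = cls v -> inJ v -> J u.
  by move=> -> hv w /clsP h; apply: hE hv => m; rewrite h.
have J0 : J 0 by apply: (JE _ [::]).
have JD u v : J u -> J v -> J (u + v).
  move=> hu hv; apply: (JE _ (scadd (repr u) (repr v))).
    by rewrite cls_add !cls_repr.
  by apply: hD; [apply: hu|apply: hv]; apply: cls_repr.
have JM u v : J v -> J (u * v).
  move=> hv; apply: (JE _ (scmul (repr u) (repr v))).
    by rewrite cls_mul !cls_repr.
  exact: hM (hv _ (cls_repr _)).
have JM' u v : J u -> J (u * v).
  move=> hu; apply: (JE _ (scmul (repr u) (repr v))).
    by rewrite cls_mul !cls_repr.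
  exact: hM' (hu _ (cls_repr _)).
have Jgen g : J (gen g - rho (gen g)).
  rewrite rho_gen /phiR; case: g => [[i j] l]; case: ifP => [_|Pg].
    by rewrite subrr.
  elim: l Pg => [|l IH] Pg /=.
    rewrite -bar_delta; apply: JE (esym (cls_barV_cst _)) _; apply: hn.
    move=> i' j' nij; rewrite mxE; case: andP => // -[/eqP ei /eqP ej].
    by move/negbT: Pg; rewrite /isP /= -ltnNge -ei -ej (negbTE nij).
  have {}IH := IH Pg; apply: (JE _ (DV (repr (gen (i, j, l) -
    (if l == 0%N then form (fmat n) (delta_mx i j) else 0)%:A)))).
    by rewrite cls_DV cls_repr linearB /= Dcst D_gen scale0r.
  exact: hDV (IH _ (cls_repr _)).
suff h t : J (t - rho t) by apply: h.
elim/mon_ind: t => [|u v hu hv|c w].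
- by rewrite linear0 subr0.
- by rewrite linearD /= opprD addrACA; apply: JD.
rewrite linearZ /= -scalerBr -mulr_algl; apply: (JM).
elim: w => [|x w IH]; first by rewrite mon_nil rmorph1 subrr.
rewrite mon_cons rmorphM /=.
have -> : gen x * mon w - rho (gen x) * rho (mon w) =
  (gen x - rho (gen x)) * mon w + rho (gen x) * (mon w - rho (mon w)).
  by rewrite mulrBl mulrBr addrA subrK.
by apply: (JD); [apply: (JM')|apply: (JM)].
Qed.

Lemma rho_inJ y : rho (cls y) = 0 -> inJ y.
Proof. by move=> h; apply: (sub_rho_inJ (s := cls y)); rewrite h subr0. Qed.

(** Membership in W, read on classes: J is the kernel of [rho], and by linearity it suffices to test
    the matrix units that span n. *)
Definition WS (s : S) :=
  rho s = s /\ forall (a b : Idx n) k, (a < b)%N -> rho (del a b k s) = 0.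

Lemma inWP (x : V n) : inW x <-> WS (cls x).
Proof.
split=> -[/inVpP hx h]; split=> //.
  move=> a b k ab; have := inJ_rho (h (delta_mx a b) _ k).
  rewrite cls_brA (bigD1 a) //= (bigD1 b) //= mxE !eqxx scale1r.
  rewrite big1 => [|j /negbTE nj]; last by rewrite mxE nj andbF scale0r.
  rewrite big1 => [|i /negbTE ni]; rewrite ?addr0; last first.
    by rewrite big1 // => j _; rewrite mxE ni scale0r.
  apply=> i j nij; rewrite mxE; case: andP => // -[/eqP ei /eqP ej].
  by rewrite ei ej ab in nij.
move=> A hA k; apply: rho_inJ; rewrite cls_brA linear_sum big1 // => i _.
rewrite linear_sum big1 // => j _; rewrite linearZ /=.
case: (ltnP i j) => ij; first by rewrite h ?scaler0.
by rewrite hA -?leqNgt // scale0r.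
Qed.

Lemma WS0 : WS 0.
Proof. by split=> [|a b k _]; rewrite !linear0. Qed.
Lemma WSD s t : WS s -> WS t -> WS (s + t).
Proof.
move=> [hs ds] [ht dt]; split=> [|a b k ab]; first by rewrite linearD /= hs ht.
by rewrite !linearD /= ds ?dt ?addr0.
Qed.
Lemma WSZ c s : WS s -> WS (c *: s).
Proof.
move=> [hs ds]; split=> [|a b k ab]; first by rewrite linearZ /= hs.
by rewrite !linearZ /= ds ?scaler0.
Qed.
Lemma WS1 : WS 1.
Proof. by split=> [|a b k _]; rewrite ?del1 ?rmorph1 ?linear0. Qed.
Lemma WSM s t : WS s -> WS t -> WS (s * t).
Proof.
move=> [hs ds] [ht dt]; split=> [|a b k ab]; first by rewrite rmorphM /= hs ht.
by rewrite delM rmorphD !rmorphM /= ds // dt // mul0r mulr0 addr0.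
Qed.
(** By sesquilinearity the chi^k coefficient at [D s] involves only the coefficients of chi^k and
    chi^(k-1) at [s]. *)
Lemma WS_D s : WS s -> WS (D s).
Proof.
move=> [hs ds]; split=> [|a b k ab]; first by rewrite rho_D hs.
rewrite delD linearZ linearB /= rho_D ds // linear0 sub0r.
by case: k => [|k] /=; [rewrite linear0|rewrite ds //]; rewrite oppr0 scaler0.
Qed.

Lemma WS_iterD l s : WS s -> WS (iter l D s).
Proof. by move=> hs; elim: l => //= l; apply: WS_D. Qed.

End ReductionModJ.

(** * Row determinants of Hessenberg matrices of operators *)

Section RowDeterminant.
Variables (R : nzRingType) (U : lmodType R).

(** The row determinant of a matrix of operators, applied to [u]: each product is a composition in
    which row 0 acts last. *)
Definition rdetop m (B : 'I_m -> 'I_m -> U -> U) (u : U) : U :=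
  \sum_(s : 'S_m) (-1) ^+ s *: foldr (fun i => B i (s i)) u (enum 'I_m).

Lemma lift_perm_onto m (j : 'I_m.+1) (F : 'S_m.+1 -> U) :
  \sum_(s : 'S_m.+1 | s ord0 == j) F s = \sum_(s : 'S_m) F (lift_perm ord0 j s).
Proof.
(* [h s] is what [s] induces on the remaining rows and columns. The default [k] is never reached,
   because [s (lift ord0 k)] differs from [s ord0]. *)
pose h (s : 'S_m.+1) (k : 'I_m) : 'I_m := odflt k (unlift (s ord0) (s (lift ord0 k))).
have hK (s : 'S_m.+1) (k : 'I_m) : lift (s ord0) (h s k) = s (lift ord0 k).
  have : s ord0 != s (lift ord0 k) by rewrite (inj_eq perm_inj) neq_lift.
  by rewrite /h; case: unliftP => [k' ->|-> /eqP].
have h_inj (s : 'S_m.+1) : injective (h s).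
  move=> k k' /(congr1 (lift (s ord0))); rewrite !hK.
  by move=> /perm_inj /lift_inj.
rewrite (reindex_onto (lift_perm ord0 j) (fun s => perm (h_inj s))) /=.
  apply: eq_bigl => s; rewrite lift_perm_id eqxx /=.
  apply/eqP/permP => k; rewrite permE; apply: (@lift_inj _ j).
  by have := hK (lift_perm ord0 j s) k; rewrite lift_perm_id lift_perm_lift.
move=> s /eqP <-; apply/permP => k; case: (unliftP ord0 k) => [k'|] ->.
  by rewrite lift_perm_lift permE hK.
by rewrite lift_perm_id.
Qed.

(** Laplace expansion along row 0 survives for non-commuting entries because the entry of row 0 is
    always the outermost factor. *)
Lemma rdetop_expand m (B : 'I_m.+1 -> 'I_m.+1 -> {additive U -> U}) u :
  rdetop (fun i j => B i j) u =
  \sum_(j < m.+1) (-1) ^+ j *: B ord0 j (rdetop (fun i k => B (lift ord0 i) (lift j k)) u).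
Proof.
rewrite /rdetop (partition_big (fun s : 'S_m.+1 => s ord0) predT) //=.
apply: eq_bigr => j _; rewrite lift_perm_onto raddf_sum scaler_sumr.
apply: eq_bigr => s _; rewrite raddfZsign scalerA odd_lift_perm /= signr_addb signr_odd.
congr (_ *: _).
rewrite enum_ordSl /= lift_perm_id foldr_map; congr (B _ _ _).
by elim: (enum _) => //= i r ->; rewrite lift_perm_lift.
Qed.

Section Hessenberg.
Variables (m0 : nat) (B : nat -> nat -> {additive U -> U}) (u : U).
Hypothesis B_sub : forall i v, B i.+1 i v = - v.
Hypothesis B_low : forall i j v, (j.+1 < i)%N -> B i j v = 0.

Definition minor m r (c : 'I_m -> nat) := rdetop (fun i j => B (r + i) (c j)) u.

Lemma eq_minor m r (c c' : 'I_m -> nat) : c =1 c' -> minor r c = minor r c'.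
Proof.
move=> cc; apply: eq_bigr => s _; congr (_ *: _).
by elim: (enum _) => //= i q ->; rewrite cc.
Qed.

Lemma minorS m r (c : 'I_m.+1 -> nat) :
  minor r c = \sum_(j < m.+1) (-1) ^+ j *: B r (c j) (minor r.+1 (c \o lift j)).
Proof.
rewrite /minor (rdetop_expand (fun i j => B (r + i) (c j))).
apply: eq_bigr => j _; rewrite addn0; congr (_ *: B _ _ _).
apply: eq_bigr => s _; congr (_ *: _).
by elim: (enum _) => //= i q ->; rewrite /bump leq0n add1n addSnnS.
Qed.

(** Column [c j] lies to the left of the subdiagonal in all rows from r on, so it is zero there. The
    expansion meets it either as the chosen entry or in the remaining minor. *)
Lemma minor_low m r (c : 'I_m -> nat) j : ((c j).+1 < r)%N -> minor r c = 0.
Proof.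
elim: m r c j => [|m IH] r c j; first by case: j.
move=> cj; rewrite minorS big1 // => j' _.
case: (unliftP j' j) cj => [k ->|->] cj; last by rewrite B_low // scaler0.
by rewrite (IH _ _ k) ?raddf0 ?scaler0 // ltnW.
Qed.

(** The trailing principal minors, which are the S_i of the recursion. *)
Definition rowdet r := @minor (m0 - r) r (fun k => r + k)%N.

(* after row r-1 has used column r-1+t, only the subdiagonal entries of the next t rows
   can fill the t columns it skipped *)
Lemma minor_skip t m r (c : 'I_m -> nat) : (r + m = m0)%N -> (t <= m)%N ->
  (forall k : 'I_m, c k = if (k < t)%N then (r + k).-1 else (r + k)%N) ->
  (0 < r)%N -> minor r c = (-1) ^+ t *: rowdet (r + t).
Proof.
elim: t m r c => [|t IH] m r c rm tm hc r_gt0.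
  rewrite expr0 scale1r addn0 /rowdet; have em : (m0 - r = m)%N by rewrite -rm addKn.
  rewrite em; apply: eq_minor => k; exact: hc.
case: m c rm tm hc => // m c rm tm hc.
(* Row r must use its first column, of index r-1: any other choice leaves this column to the rows
   from r+1 on, where it vanishes. *)
rewrite minorS (bigD1 ord0) //= big1 => [|j nj]; last first.
  have [k jk] : exists k, lift j k = ord0.
    by case: (unliftP j ord0) => [k ->|j0]; [exists k|rewrite j0 eqxx in nj].
  rewrite (@minor_low _ _ _ k) ?raddf0 ?scaler0 //= jk hc /= addn0.
  by rewrite prednK.
rewrite addr0 expr0 scale1r hc /= addn0 -{1}(prednK r_gt0) B_sub.
rewrite (IH m r.+1) //; first by rewrite exprS mulN1r scaleNr addSnnS.
- by rewrite addSnnS.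
- move=> k /=; rewrite hc /= /bump /= add1n ltnS.
  by case: ifP => _; rewrite addnS ?addSn.
Qed.

Lemma rowdet_top : rowdet m0 = u.
Proof.
rewrite /rowdet subnn /minor /rdetop.
have -> : enum 'I_0 = [::] by apply/eqP; rewrite -size_eq0 size_enum_ord.
rewrite /= (bigD1 (1%g : 'S_0)) //= big1 => [|s /eqP []]; last by apply/permP => -[].
by rewrite odd_perm1 expr0 scale1r addr0.
Qed.

(** Once row r takes column r+j, the j skipped columns are filled by subdiagonal entries -1. Their
    product [(-1)^j] cancels the sign of the expansion. *)
Lemma rowdetE r : (r < m0)%N ->
  rowdet r = \sum_(r <= j < m0) B r j (rowdet j.+1).
Proof.
move=> rm; have [m em] : exists m, (m0 - r = m.+1)%N.
  by exists (m0 - r).-1; rewrite prednK // subn_gt0.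
have em0 : (r.+1 + m = m0)%N by rewrite addSnnS -em subnKC // ltnW.
rewrite -[X in index_iota X]add0n big_addn big_mkord em {1}/rowdet em minorS.
apply: eq_bigr => j _.
have hj k : (fun k => r + k)%N (lift j k) =
    if (k < j)%N then (r.+1 + k).-1 else (r.+1 + k)%N.
  by rewrite /= /bump leqNgt; case: ltnP => _ //=; rewrite add1n addnS.
rewrite (minor_skip em0 _ hj) // -1?ltnS // raddfZsign scalerA -exprD addnn.
by rewrite -muln2 exprM sqrr_sign scale1r addSn addnC.
Qed.

Lemma rowdet0 : rowdet 0 = rdetop (fun i j : 'I_m0 => B i j) u.
Proof.
by rewrite /rowdet subn0.
Qed.

End Hessenberg.
End RowDeterminant.

(** * Polynomials in D with coefficients on the left *)

Section LeftMultiplicationByD.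
Variables (X : countType) (par : X -> bool) (sh : X -> X).
Hypothesis par_sh : forall x, par (sh x) = ~~ par x.
Local Notation S := (superalg par).

(* coefficients of D o (sum_k q_k D^k), a polynomial in D with coefficients on the left *)
Definition leftD (q : {poly S}) : {poly S} :=
  map_poly (dif par_sh) q + map_poly (sg true) q * 'X.

Lemma coef_leftD q k : (leftD q)`_k =
  dif par_sh q`_k + if k is k'.+1 then sg true q`_k' else 0.
Proof.
rewrite coefD coefMX; congr (_ + _); first by rewrite coef_map_id0 // linear0.
by case: k => //= k; rewrite coef_map_id0 // linear0.
Qed.

Lemma leftD_additive : zmod_morphism leftD.
Proof.
move=> p q; apply/polyP => k; rewrite !(coefB, coef_leftD) !linearB /=.
by case: k => [|k]; rewrite ?subr0 ?addr0 // !coefB !linearB /= opprD addrACA.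
Qed.
HB.instance Definition _ :=
  GRing.isZmodMorphism.Build {poly S} {poly S} leftD leftD_additive.

End LeftMultiplicationByD.

(** * The row determinant of A as a composition of operators *)

Section RowDeterminantA.
Variable n : nat.
Local Notation N := (N n).
Local Notation S := (superalg (@parG n)).
Local Notation cls := (cls (@parG n)).
Local Notation gen := (gen (@parG n)).
Local Notation mon := (mon (@parG n)).
Local Notation D := (@D n).
Local Notation leftD := (leftD (@parG_Dg n)).

(** The entry (i, j) of A without its D, with the transposed indices and the sign of e^(ji). For i >
    j it is a generator from n. *)
Definition ebar (i j : Idx n) : S := sgn (pI j) *: gen (j, i, 0%N).

(** Left multiplication by the entry (i, j) of A. The indeterminate stands for D, but the product of
    [{poly S}] is not that of operators: the twist is inside [leftD]. *)
Definition opA (i j : Idx n) (q : {poly S}) : {poly S} :=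
  (if i == j then leftD q else 0) +
  (if (i <= j)%N then ebar i j *: q
   else if i == j.+1 :> nat then - q else 0).

Lemma opA_additive i j : zmod_morphism (opA i j).
Proof.
move=> p q; rewrite /opA [in RHS]opprD [RHS]addrACA; congr (_ + _).
  by case: eqP; rewrite ?raddfB ?subr0.
by case: ifP => _; [rewrite scalerBr|case: eqP; rewrite ?subr0 ?opprD].
Qed.
HB.instance Definition _ i j :=
  GRing.isZmodMorphism.Build {poly S} {poly S} (opA i j) (opA_additive i j).

Definition polyV (l : VD n) : {poly S} := \poly_(k < size l) cls (nth [::] l k).

Lemma coef_polyV l k : (polyV l)`_k = cls (nth [::] l k).
Proof. by rewrite coef_poly; case: ltnP => // h; rewrite nth_default. Qed.

Lemma polyV_add p q : polyV (vdadd p q) = polyV p + polyV q.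
Proof. by apply/polyP=> k; rewrite coefD !coef_polyV cls_vdadd. Qed.

Lemma polyV_nil : polyV [::] = 0.
Proof. by apply/polyP=> k; rewrite coef_polyV coef0 nth_nil. Qed.

Lemma polyV_scale c p : polyV (vdscale c p) = (c%:A : S) *: polyV p.
Proof.
apply/polyP=> k; rewrite coefZ !coef_polyV mulr_algl.
by apply: (@cls_nth_map _ _ (scscale c) ( *:%R c)) => // v; exact: cls_scale.
Qed.

Lemma polyV_lmul a p : polyV (vdlmul a p) = cls a *: polyV p.
Proof.
apply/polyP=> k; rewrite coefZ !coef_polyV.
case: (ltnP k (size p)) => h; last by rewrite !nth_default ?size_map // mulr0.
by rewrite (nth_map [::]) // cls_mul.
Qed.

Lemma polyV_leftD p : polyV (vdleftD p) = leftD (polyV p).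
Proof.
rewrite /vdleftD polyV_add; apply/polyP=> k; rewrite coefD coef_leftD !coef_polyV.
congr (_ + _); first by rewrite (@cls_nth_map _ _ (@DV n) D) // => v; apply: cls_DV.
case: k => [|k] //=; rewrite coef_polyV.
by rewrite (@cls_nth_map _ _ (@scsgn _ (@parG n)) (sg true)) // => v; apply: cls_scsgn.
Qed.

Lemma polyV_foldr_add ps : polyV (foldr (@vdadd n) [::] ps) = \sum_(p <- ps) polyV p.
Proof.
elim: ps => [|p ps IH] /=; first by rewrite big_nil polyV_nil.
by rewrite polyV_add IH big_cons.
Qed.

Lemma polyV_Aent i j q : polyV (vdmul (Aent i j) q) = opA i j (polyV q).
Proof.
have h0 : cls [::] = 0 by [].
rewrite /vdmul polyV_foldr_add big_map /opA /Aent; case: ifP => ij.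
  rewrite /= !big_cons big_nil !polyV_lmul addr0 addrC /= polyV_leftD.
  congr (_ + _).
    by case: eqP; rewrite ?scale1r ?h0 ?scale0r.
  by congr (_ *: _); rewrite cls_sum big_seq1.
have -> : (i == j) = false by apply/eqP => e; rewrite e leqnn in ij.
rewrite add0r; case: eqP => _ /=; rewrite ?big_cons big_nil ?addr0 // polyV_lmul.
by rewrite cls_cst scaleN1r.
Qed.

Lemma polyV_rdet : polyV (rdet n) = rdetop opA 1.
Proof.
rewrite /rdet polyV_foldr_add big_map big_enum; apply: eq_bigr => s _ /=.
rewrite polyV_scale; congr (_ *: _).
  by case: odd_perm; rewrite /sgn ?scaleN1r ?scale1r ?expr0 ?expr1.
elim: (enum _) => [|i r IH] /=; last by rewrite polyV_Aent IH.
apply/polyP=> k; rewrite coef_polyV coef1; case: k => [|k] //=.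
by rewrite nth_nil.
Qed.

Lemma inord_small (i : nat) : (i < N)%N -> (inord i : Idx n) = i :> nat.
Proof. by move=> h; rewrite inordK. Qed.

(** Extends the entries to all natural indices while keeping -1 on the whole subdiagonal, so that
    the Hessenberg recursion applies. *)
Definition opN (i j : nat) : {additive {poly S} -> {poly S}} :=
  if (i < N)%N && (j < N)%N then (opA (inord i) (inord j) : {additive _ -> _})
  else if i == j.+1 then (-%R : {additive _ -> _}) else (\0 : {additive _ -> _}).

Definition Srow := rowdet N opN 1.

Lemma opN_sub i v : opN i.+1 i v = - v.
Proof.
rewrite /opN eqxx; case: ifP => // /andP[hi hj]; rewrite /= /opA -val_eqE /=.
by rewrite !inord_small // eqxx ltnn gtn_eqF // add0r.
Qed.

Lemma opN_low i j v : (j.+1 < i)%N -> opN i j v = 0.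
Proof.
move=> ji; rewrite /opN (gtn_eqF ji); case: ifP => // /andP[hi hj].
rewrite /= /opA -val_eqE /= (inord_small hi) (inord_small hj).
have lt_ji := ltnW ji; by rewrite (gtn_eqF lt_ji) (gtn_eqF ji) leqNgt lt_ji addr0.
Qed.

Lemma Srow_top : Srow N = 1. Proof. exact: rowdet_top. Qed.

Lemma Srow_rdet : Srow 0 = polyV (rdet n).
Proof.
rewrite polyV_rdet /Srow rowdet0; apply: eq_bigr => s _; congr (_ *: _).
by elim: (enum _) => //= i r ->; rewrite /opN !ltn_ord !inord_val.
Qed.

Lemma SrowE (i : Idx n) :
  Srow i = leftD (Srow i.+1) + \sum_(j : Idx n | (i <= j)%N) ebar i j *: Srow j.+1.
Proof.
rewrite /Srow (rowdetE _ opN_sub opN_low) //.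
rewrite (big_nat_widenl _ 0) // big_mkord.
transitivity (\sum_(j < N | (i <= j)%N) ((if i == j then leftD (Srow j.+1) else 0)
  + ebar i j *: Srow j.+1)).
  by apply: eq_bigr => j /= ij; rewrite /opN !ltn_ord /= !inord_val /opA ij.
rewrite big_split /=; congr (_ + _).
rewrite (bigD1 i) //= eqxx big1 ?addr0 // => j /andP[_ /negbTE].
by rewrite eq_sym => ->.
Qed.

End RowDeterminantA.

(** * Invariance of the row determinant *)

Section InvariantCoefficients.
Variable n : nat.
Local Notation N := (N n).
Local Notation S := (superalg (@parG n)).
Local Notation cls := (cls (@parG n)).
Local Notation gen := (gen (@parG n)).
Local Notation mon := (mon (@parG n)).
Local Notation D := (@D n).
Local Notation rho := (@rho n).
Local Notation ebar := (@ebar n).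

(** The coefficient of D^m in D times [sum_m q_m D^m], with the q_m given by a function so that the
    bracket can be applied to each of them. *)
Definition ldcoef (q : nat -> S) (m : nat) : S :=
  D (q m) + if m is m'.+1 then sg true (q m') else 0.

Lemma ldcoef_opp q m : ldcoef (fun m => - q m) m = - ldcoef q m.
Proof.
by rewrite /ldcoef !linearN opprD; case: m => [|m] /=; rewrite ?oppr0 // linearN.
Qed.

Lemma eq_ldcoef (q q' : nat -> S) m : q =1 q' -> ldcoef q m = ldcoef q' m.
Proof. by move=> h; rewrite /ldcoef h; case: m => // m; rewrite h. Qed.

Lemma ldcoef_eq0 (q : nat -> S) m : (forall m, q m = 0) -> ldcoef q m = 0.
Proof.
by move=> h; rewrite /ldcoef h linear0 add0r; case: m => // m; rewrite h linear0.
Qed.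

Definition tS (i m : nat) : S := (Srow n i)`_m.

Lemma tS_top m : tS N m = (m == 0%N)%:R.
Proof. by rewrite /tS Srow_top coef1. Qed.

Lemma tSE (i : Idx n) m : tS i m =
  ldcoef (tS i.+1) m + \sum_(j : Idx n | (i <= j)%N) ebar i j * tS j.+1 m.
Proof.
rewrite /tS SrowE coefD coef_leftD; congr (_ + _).
by rewrite coef_sum; apply: eq_bigr => j _; rewrite coefZ.
Qed.

(** Reduction modulo J thus produces the whole Hessenberg matrix apart from D: the subdiagonal -1 is
    (f|e_(j,j+1)) with the sign of e^(j,j+1). *)
Lemma rho_ebar (i j : Idx n) : rho (ebar i j) =
  if (i <= j)%N then ebar i j else if i == j.+1 :> nat then -1 else 0.
Proof.
rewrite /ebar linearZ /= rho_gen /phiR /isP /=; case: ifP => // ij.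
rewrite form_f_delta scalerA; case: eqP => ij'; last by rewrite mulr0 scale0r.
by rewrite -sgnD /pI ij' oddS; case: odd; rewrite /sgn scaleN1r.
Qed.

Lemma Idx_down_ind (P : nat -> Prop) : P N ->
  (forall i : Idx n, (forall j, (i < j)%N -> (j <= N)%N -> P j) -> P i) ->
  forall i, (i <= N)%N -> P i.
Proof.
move=> PN PS.
suff h r i : (i <= N)%N -> (N <= i + r)%N -> P i.
  by move=> i iN; apply: (h N) => //; apply: leq_addl.
elim: r i => [|r IH] i iN Ni.
  suff -> : i = N by [].
  by apply/eqP; rewrite eqn_leq iN -(addn0 i).
case: (ltnP i N) => ltiN; last by suff -> : i = N by []; apply/eqP; rewrite eqn_leq iN.
apply: (PS (Ordinal ltiN)) => j ij jN; apply: IH => //.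
by apply: leq_trans Ni _; rewrite addnS -addSn leq_add2r.
Qed.

Lemma rho_tS i m : (i <= N)%N -> rho (tS i m) = tS i m.
Proof.
move=> iN; move: i iN m; apply: Idx_down_ind => [|i IH] m.
  by rewrite tS_top rmorph_nat.
rewrite tSE linearD linear_sum /=; congr (_ + _).
  rewrite /ldcoef linearD /= rho_D IH // ; congr (_ + _).
  by case: m => [|m]; rewrite ?linear0 // rho_sg IH.
by apply: eq_bigr => j ij; rewrite rmorphM /= rho_ebar ij IH.
Qed.

Section Invariance.
Variables a b : Idx n.
Hypothesis ab : (a < b)%N.
Let s := pI a (+) pI b.
Let dd k u := rho (del a b k u).

Lemma dd_sum k (I : Type) (r : seq I) (P : pred I) F :
  dd k (\sum_(i <- r | P i) F i) = \sum_(i <- r | P i) dd k (F i).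
Proof. by rewrite /dd (linear_sum (del a b k)) (linear_sum rho). Qed.

Lemma ddD k u v : dd k (u + v) = dd k u + dd k v.
Proof. by rewrite /dd !linearD. Qed.

(** The last term, one power of chi lower, arises from moving D out of the bracket. It is what will
    cancel the constant (e_ab|e_ba). *)
Lemma dd_ldcoef k q m : dd k (ldcoef q m) = sgn (s (+) odd k) *:
  (ldcoef (fun m => dd k (q m)) m - (if k is k'.+1 then dd k' (q m) else 0)).
Proof.
rewrite /ldcoef ddD {1}/dd delD linearZ linearB /= rho_D -/(dd k _) -/s.
rewrite addrAC [in RHS]scalerDr; congr (_ *: (_ - _) + _).
  by case: k => [|k] //; rewrite linear0.
case: m => [|m]; first by rewrite /dd !linear0.
by rewrite /dd del_sg linearZ /= rho_sg.
Qed.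

Lemma dd_mul k (i j : Idx n) v : (i <= j)%N -> rho v = v -> dd k (ebar i j * v) =
  dd k (ebar i j) * v +
  sgn ((s (+) odd k) && ~~ (pI i (+) pI j)) *: (ebar i j * dd k v).
Proof.
move=> ij hv; rewrite /dd delM rmorphD !rmorphM /= hv; congr (_ + _).
rewrite rho_sg rho_ebar ij /ebar linearZ /= sg_gen /parG /= addbT.
by rewrite -!scalerAl !scalerA mulrC (addbC (pI j)).
Qed.

(** At chi^0 the bracket acts like an elementary operation: entry (i, b) goes to entry (i, a) and
    entry (a, j) to entry (b, j), up to sign. *)
Lemma dd0_ebar (i j : Idx n) : dd 0 (ebar i j) =
  (if j == b then sgn (s && (pI i (+) pI b)) *: rho (ebar i a) else 0) -
  (if i == a then sgn s *: rho (ebar b j) else 0).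
Proof.
rewrite /dd {1}/ebar linearZ /= del_gen dgen0 bar_sbr linearZ linearZ /= -/s.
rewrite linearB /= linearZ /= scalerA scalerBr (eq_sym j) (eq_sym i).
congr (_ - _).
  case: eqP => [<-|_]; last by rewrite linear0 scaler0.
  rewrite /ebar [in RHS]linearZ /= scalerA -!sgnD; congr (sgn _ *: _).
  by rewrite /s; case: (pI a); case: (pI b); case: (pI i).
case: eqP => [<-|_]; last by rewrite scaler0 linear0 scaler0.
rewrite /ebar !linearZ /= !scalerA -!sgnD; congr (sgn _ *: _).
by rewrite /s; case: (pI a); case: (pI b); case: (pI j).
Qed.

Lemma ddS_ebar k (i j : Idx n) : dd k.+1 (ebar i j) =
  if [&& k == 0%N, i == a & j == b] then (sgn s)%:A else 0.
Proof.
rewrite /dd /ebar linearZ /= del_gen dgen0; case: k => [|k]; last by rewrite scaler0 linear0.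
rewrite form_delta /= (eq_sym i) (eq_sym j) andbC.
case: andP => [[_ /eqP <-]|_]; last by rewrite scale0r scaler0 linear0.
by rewrite !linearZ /= rmorph1 scalerA -sgnD addbC.
Qed.

(** By the recursion the columns j >= b give [S_b - D S_(b+1)]. The subdiagonal -1 in column b-1,
    which is at least a, removes S_b. *)
Lemma row_b m : \sum_(j : Idx n | (a <= j)%N) rho (ebar b j) * tS j.+1 m =
  - ldcoef (tS b.+1) m.
Proof.
have b_gt0 : (0 < b)%N by apply: leq_ltn_trans ab.
have hb : (b.-1 < N)%N by apply: leq_ltn_trans (leq_pred _) (ltn_ord b).
pose b' : Idx n := Ordinal hb.
rewrite (bigID (fun j : Idx n => (b <= j)%N)) /=.
have -> : \sum_(i < N | (a <= i)%N && (b <= i)%N) rho (ebar b i) * tS i.+1 m =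
    \sum_(j : Idx n | (b <= j)%N) ebar b j * tS j.+1 m.
  apply: eq_big => [j|j /andP[_ bj]]; last by rewrite rho_ebar bj.
  by case: (leqP b j) => bj; rewrite ?andbF // andbT (leq_trans (ltnW ab)).
rewrite [X in _ + X](bigD1 b') /=; last first.
  by rewrite -ltnNge /= ltn_predL b_gt0 andbT -ltnS prednK.
rewrite [X in _ + (_ + X)]big1 => [|j /andP[/andP[_ bj] jb']]; last first.
  rewrite rho_ebar (negbTE bj); case: eqP; last by rewrite mul0r.
  by move=> e; case/eqP: jb'; apply: val_inj; rewrite /= e.
rewrite rho_ebar /= leqNgt prednK // leqnn eqxx mulN1r addr0.
by rewrite (tSE b) opprD addrCA subrr addr0.
Qed.

Lemma dd_tS i : (i <= N)%N -> forall k m, dd k (tS i m) =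
  if (i == a.+1) && (k == 0%N) then - tS b.+1 m else 0.
Proof.
move: i; apply: Idx_down_ind => [|i IH] k m.
  (* S_N = 1 is killed, and N is not a+1 because a < b < N. *)
  rewrite tS_top (gtn_eqF (leq_ltn_trans ab (ltn_ord b))) /=.
  by case: (m == 0%N); rewrite /dd ?del1 !linear0.
rewrite tSE ddD dd_ldcoef dd_sum.
have IHS k' m' (j : Idx n) : (i <= j)%N ->
  dd k' (tS j.+1 m') = if (j == a) && (k' == 0%N) then - tS b.+1 m' else 0.
  by move=> ij; rewrite IH // eqSS.
(* By induction, among the S_(j+1) with j >= i only S_(a+1) has a nonzero bracket, and only at
   chi^0. *)
have -> : \sum_(j : Idx n | (i <= j)%N) dd k (ebar i j * tS j.+1 m) =
  \sum_(j : Idx n | (i <= j)%N) dd k (ebar i j) * tS j.+1 m -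
  (if (i <= a)%N && (k == 0%N) then
    sgn (s && ~~ (pI i (+) pI a)) *: (ebar i a * tS b.+1 m) else 0).
  under eq_bigr => j ij do rewrite dd_mul ?rho_tS // IHS //.
  rewrite big_split /=; congr (_ + _); case: eqP => [->|_]; last first.
    rewrite andbF oppr0 big1 // => j _.
    by rewrite andbF mulr0 scaler0.
  rewrite andbT addbF; case: ifP => ia.
    rewrite (bigD1 a) //= eqxx big1 ?addr0 => [|j /andP[_ /negbTE ->]].
      by rewrite mulrN scalerN.
    by rewrite mulr0 scaler0.
  rewrite oppr0 big1 // => j ij; case: eqP => [ja|_]; last by rewrite mulr0 scaler0.
  by rewrite -ja ij in ia.
(* Positive powers of chi contribute only in row a at chi^1: the constant (e_ab|e_ba) times S_(b+1)
   cancels the chi-term from D S_(a+1). *)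
case: k => [|k]; last first.
  rewrite !andbF subr0 ldcoef_eq0 => [|m']; last by rewrite IHS // andbF.
  rewrite IHS // sub0r.
  under eq_bigr do rewrite ddS_ebar.
  case: (eqVneq i a) => [ia|ia] /=; last first.
    by rewrite oppr0 scaler0 add0r big1 // => j _; rewrite andbF mul0r.
  case: (eqVneq k 0%N) => [->|_] /=; last first.
    by rewrite oppr0 scaler0 add0r big1 // => j _; rewrite mul0r.
  rewrite (bigD1 b) /=; last by rewrite ia ltnW.
  rewrite eqxx big1 ?addr0 => [|j /andP[_ /negbTE ->]]; last by rewrite mul0r.
  by rewrite opprK mulr_algl -scalerDl addbT sgnN addNr scale0r.
rewrite subr0 addbF !andbT.
have -> : ldcoef (fun m => dd 0 (tS i.+1 m)) m =
    if i == a then - ldcoef (tS b.+1) m else 0.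
  case: eqP => [ia|/eqP/negbTE ia].
    by rewrite {1}ia -ldcoef_opp; apply: eq_ldcoef => m'; rewrite (IHS 0%N m' a) ?eqxx // ia.
  by apply: ldcoef_eq0 => m'; rewrite (IHS 0%N m' i) // ia.
under eq_bigr do rewrite dd0_ebar mulrBl.
rewrite sumrB.
have -> : \sum_(j : Idx n | (i <= j)%N)
    (if j == b then sgn (s && (pI i (+) pI b)) *: rho (ebar i a) else 0) * tS j.+1 m =
  if (i <= b)%N then sgn (s && (pI i (+) pI b)) *: (rho (ebar i a) * tS b.+1 m) else 0.
  case: ifP => ib.
    rewrite (bigD1 b) //= eqxx big1 ?addr0 => [|j /andP[_ /negbTE ->]].
      by rewrite -scalerAl.
    by rewrite mul0r.
  rewrite big1 // => j ij; case: eqP => [jb|_]; last by rewrite mul0r.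
  by rewrite -jb ij in ib.
(* Row a: by [row_b] the replacement of row a cancels the bracket of D S_(a+1), and the two terms
   with the entry (a, a) times S_(b+1) cancel each other. *)
case: (eqVneq i a) => [ia|ia].
  subst i; under [X in _ + (_ - X - _)]eq_bigr do rewrite -scalerAl.
  rewrite -scaler_sumr row_b (ltnW ab) leqnn ltn_eqF //.
  rewrite rho_ebar leqnn !scalerN.
  have -> : s && ~~ (pI a (+) pI a) = s && (pI a (+) pI b).
    by rewrite /s; case: (pI a); case: (pI b).
  by rewrite addrAC subrr add0r opprK addNr.
rewrite scaler0 add0r [X in _ - X - _]big1 ?subr0 => [|j _]; last by rewrite mul0r.
(* Rows i < a: the entry (i, b) moved to (i, a), times S_(b+1), cancels the entry (i, a) times the
   bracket of S_(a+1). *)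
rewrite rho_ebar; case: (leqP i a) => iale.
  rewrite (leq_trans iale (ltnW ab)) ltn_eqF //.
  apply/eqP; rewrite subr_eq0; apply/eqP.
  congr (sgn _ *: _); rewrite /s; by case: (pI a); case: (pI b); case: (pI i).
(* Rows i > a: the moved entry (i, a) lies below the diagonal. It is nonzero only for i = a+1, where
   its value -1 gives - S_(b+1). *)
rewrite subr0; case: eqP => [ia1|_]; last by rewrite mul0r scaler0 if_same.
rewrite ia1 ab mulN1r scalerN /s /pI ia1 oddS.
by case: (odd a); case: (odd b); rewrite /= scale1r.
Qed.

End Invariance.

Lemma cls_nth_rdet m : cls (nth [::] (rdet n) m) = tS 0 m.
Proof. by rewrite -coef_polyV -Srow_rdet. Qed.

Lemma WS_tS0 m : WS (tS 0 m).
Proof. by split=> [|a b k ab]; [apply: rho_tS|rewrite dd_tS]. Qed.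

Lemma tS_high i m : (i <= N)%N -> (N < m + i)%N -> tS i m = 0.
Proof.
move=> iN; move: i iN m; apply: Idx_down_ind => [|i IH] m.
  by case: m => [|m]; rewrite ?add0n ?ltnn // tS_top.
move=> h; rewrite tSE /ldcoef IH ?linear0 ?add0r //; last first.
  by rewrite addnS ltnW.
rewrite big1 ?addr0 => [|j ij]; last first.
  by rewrite IH ?mulr0 // addnS ltnS ltnW // (leq_trans h) // leq_add2l.
case: m h => [|m] h //; rewrite IH ?linear0 //.
by rewrite addnS -addSn.
Qed.

End InvariantCoefficients.

(** * Restriction to the first row of A *)

Section FirstRow.
Variable n : nat.
Local Notation N := (N n).
Local Notation S := (superalg (@parG n)).
Local Notation SY := (superalg (@parY n)).
Local Notation clsY := (cls (@parY n)).
Local Notation genY := (gen (@parY n)).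
Local Notation cls := (cls (@parG n)).
Local Notation gen := (gen (@parG n)).
Local Notation mon := (mon (@parG n)).
Local Notation D := (@D n).
Local Notation tS := (@tS n).

Definition shY (y : Sym n) : Sym n := (y.1, y.2.+1).

Lemma parY_sh y : parY (shY y) = ~~ parY y.
Proof. by rewrite /parY /= addnS. Qed.

Local Notation DY := (dif parY_sh).

(** The sign undoes that of [ebar], so that the entry in row 0 and column j becomes exactly the
    symbol (j, 0). *)
Definition phiE (g : Gen n) : SY :=
  if g.1.2 == 0%N :> nat then sgn (pI g.1.1) *: genY (g.1.1, g.2) else 0.

Lemma phiE_homog g : homog (parG g) (phiE g).
Proof.
rewrite /phiE; case: eqP => [g0|_]; last exact: homog0.
apply: homogZ; have := homog_gen (@parY n) (g.1.1, g.2).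
by congr (homog _ _); rewrite /parG /parY /pI g0 /= oddD /= addbF; case: odd; case: odd.
Qed.

Lemma phiE_comm : supercomm (@parG n) phiE.
Proof.
move=> x y; have := erefl (phiE x); rewrite {2}/phiE; case: eqP => [x0|_] ->; last first.
  by rewrite mul0r mulr0 scaler0.
rewrite -scalerAl -scalerAr gen_comm (homog_sg _ (phiE_homog y)) -scalerAl.
rewrite !scalerA mulrC; congr (sgn (_ && _) * _ *: _).
by rewrite /parG /parY /pI x0 /= oddD /= addbF; case: odd; case: odd.
Qed.

Definition eta : S -> SY := ahom phiE_comm.
HB.instance Definition _ := GRing.LRMorphism.copy eta (ahom phiE_comm).

Lemma eta_gen g : eta (gen g) = phiE g.
Proof. exact: ahom_gen. Qed.

Lemma eta_sg b s : eta (sg b s) = sg b (eta s).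
Proof.
apply: (lin_mon_eq (f := eta \o sg b) (g := sg b \o eta)) => w /=.
elim: w => [|x w IH]; first by rewrite mon_nil rmorph1 !sg1 rmorph1.
rewrite mon_cons sgM !rmorphM /= sgM IH; congr (_ * _).
by rewrite sg_gen linearZ /= eta_gen (homog_sg _ (phiE_homog x)).
Qed.

Lemma eta_D s : eta (D s) = DY (eta s).
Proof.
apply: (lin_mon_eq (f := eta \o D) (g := DY \o eta)) => w /=.
elim: w => [|x w IH]; first by rewrite mon_nil D1 rmorph1 dif1 linear0.
rewrite mon_cons DM rmorphD !rmorphM /= difM IH eta_sg; congr (_ * _ + _).
case: x {IH} => [[c d] l]; rewrite D_gen !eta_gen /phiE /=.
by case: eqP => _; rewrite ?linear0 // linearZ /= dif_gen.
Qed.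

Lemma eta_ebar (i j : Idx n) :
  eta (ebar i j) = if i == 0%N :> nat then genY (j, 0%N) else 0.
Proof.
rewrite /ebar linearZ /= eta_gen /phiE /=; case: eqP => _; rewrite ?scaler0 //.
by rewrite scalerA sgnK scale1r.
Qed.

Lemma eta_ldcoef q m : eta (ldcoef q m) =
  DY (eta (q m)) + if m is m'.+1 then sg true (eta (q m')) else 0.
Proof.
rewrite /ldcoef linearD /= eta_D; congr (_ + _).
by case: m => [|m]; rewrite ?linear0 // eta_sg.
Qed.

(** Below row 0 only the D on the diagonal survives, so S_i becomes D^(N-i). *)
Lemma eta_tS i m : (i <= N)%N -> (0 < i)%N -> eta (tS i m) = (m == N - i)%N%:R.
Proof.
move=> iN; move: i iN m; apply: Idx_down_ind => [|i IH] m i_gt0.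
  by rewrite tS_top rmorph_nat subnn.
rewrite tSE linearD linear_sum /= big1 => [|j ij]; last first.
  by rewrite rmorphM /= eta_ebar gtn_eqF // mul0r.
rewrite addr0 eta_ldcoef !IH //; set b := (m == _).
have -> : DY b%:R = 0 by case: b; rewrite ?dif1 ?linear0.
rewrite add0r -{}/b; case: m => [|m]; first by rewrite ltn_eqF // subn_gt0.
rewrite IH // subnS -subn1 -[in RHS](subnK (_ : 0 < N - i)%N) ?subn_gt0 //.
by rewrite addn1 eqSS; case: eqP => _; rewrite ?sg1 ?linear0.
Qed.

(** S_0 becomes [D^N + sum_j y_j D^(N-j-1)], and D^(N-k-1) lies below the leading term. *)
Lemma eta_tS0 (k : Idx n) : eta (tS 0 (N - k.+1)) = genY (k, 0%N).
Proof.
pose o : Idx n := ord0.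
rewrite -[0%N]/(o : nat) tSE linearD linear_sum /= (bigD1 k) //= big1 => [|j jk].
  rewrite addr0 eta_ldcoef rmorphM /= eta_ebar !eta_tS //= eqxx mulr1.
  rewrite -[RHS]add0r; congr (_ + _); set c := (_ == _).
  have -> : DY c%:R = 0 by case: c; rewrite ?dif1 ?linear0.
  rewrite add0r; case E: (N - k.+1)%N => [|m] //; rewrite eta_tS // ltn_eqF ?linear0 //.
  by rewrite -E; apply: leq_sub2l.
rewrite rmorphM /= eta_tS //; case: eqP => [e|_]; last by rewrite mulr0.
have /eqP : k.+1 = j.+1 by rewrite -(subKn (ltn_ord k)) e subKn.
by rewrite eqSS => /eqP kj; case/eqP: jk; apply: val_inj.
Qed.

Lemma cls_wY y : cls (wY y) = iter y.2 D (tS 0 (N - y.1.+1)).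
Proof.
rewrite /wY; elim: (y.2) => [|l IH] /=; first exact: cls_nth_rdet.
by rewrite cls_DV IH.
Qed.

Lemma cls_foldr_mul (l : seq (V n)) :
  cls (foldr (@scmul (Gen n)) (sc1 (Gen n)) l) = \prod_(v <- l) cls v.
Proof.
by elim: l => [|v l IH] /=; rewrite ?big_nil // big_cons cls_mul IH.
Qed.

Lemma cls_evalY P : cls (evalY P) = \sum_(t <- P) t.1 *: \prod_(y <- t.2) cls (wY y).
Proof.
rewrite cls_flatten big_map; apply: eq_bigr => t _.
by rewrite cls_scale cls_foldr_mul big_map.
Qed.

Lemma eta_wY y : eta (cls (wY y)) = genY y.
Proof.
rewrite cls_wY; case: y => k l /=; elim: l => [|l IH] /=; first exact: eta_tS0.
by rewrite eta_D IH dif_gen.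
Qed.

(** [eta] commutes with the derivations, so each derivative of w_k goes to its own free generator.
    This left inverse of evaluation gives freeness. *)
Lemma eta_evalY P : eta (cls (evalY P)) = clsY P.
Proof.
rewrite cls_evalY linear_sum cls_sum; apply: eq_bigr => t _ /=.
rewrite linearZ /= rmorph_prod mon_prod; congr (_ *: _).
by apply: eq_bigr => y _; apply: eta_wY.
Qed.

Lemma WS_evalY P : WS (cls (evalY P)).
Proof.
rewrite cls_evalY; elim/big_ind: _ => [||t _]; [exact: WS0|exact: WSD|apply: WSZ].
elim/big_ind: _ => [||y _]; [exact: WS1|exact: WSM|].
by rewrite cls_wY; apply/WS_iterD/WS_tS0.
Qed.

End FirstRow.

(** * Leading terms *)

Section PartialDerivative.
Variables (X : countType) (par : X -> bool) (g : X).
Local Notation S := (superalg par).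
Local Notation gen := (gen par).
Local Notation mon := (mon par).

Lemma pd_derok : derok (par g) (fun x => (x == g)%:R : S).
Proof.
move=> x; case: eqP => [->|_]; last exact: homog0.
by rewrite addbb; apply: homog1.
Qed.

Definition pd : S -> S := der pd_derok.
HB.instance Definition _ := GRing.Linear.copy pd (der pd_derok).

Lemma pd_mon_cons x w :
  pd (mon (x :: w)) = (x == g)%:R * mon w +
    sgn (par g && par x) *: (gen x * pd (mon w)).
Proof. by rewrite /pd !der_mon. Qed.

Lemma gen_pd_mon w : gen g * pd (mon w) = (count_mem g w)%:R *: mon w.
Proof.
elim: w => [|x w IH] /=; first by rewrite mon_nil /pd der1 mulr0 scale0r.
rewrite pd_mon_cons mulrDr -scalerAr [gen g * (gen x * _)]mulrA gen_swap -scalerAl scalerA -sgnD addbb.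
rewrite scale1r -mulrA IH -scalerAr -mon_cons natrD scalerDl; congr (_ + _).
by case: eqP => [->|_]; rewrite ?mul0r ?mulr0 ?scale0r // mul1r scale1r mon_cons.
Qed.

(** This Euler operator is diagonal on monomials, so it detects those containing [g] without the
    sign of a position. *)
Lemma coefS_gen_pd s m : coefS (gen g * pd s) m = (count_mem g m)%:R * coefS s m.
Proof.
elim/mon_ind: s => [|s t hs ht|c w].
- by rewrite linear0 mulr0 !coefS0 mulr0.
- by rewrite linearD mulrDr !coefSD hs ht mulrDr.
rewrite linearZ /= -scalerAr gen_pd_mon !coefSZ.
case: (eqVneq (coefS (mon w) m) 0) => [->|/coefS_mon_perm /seq.permP h]; first by rewrite !mulr0.
by rewrite h mulrCA.
Qed.

End PartialDerivative.

(** * Injectivity of [eta] on W *)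

Section Generation.
Variable n : nat.
Local Notation N := (N n).
Local Notation S := (superalg (@parG n)).
Local Notation SY := (superalg (@parY n)).
Local Notation cls := (cls (@parG n)).
Local Notation gen := (gen (@parG n)).
Local Notation mon := (mon (@parG n)).
Local Notation D := (@D n).
Local Notation rho := (@rho n).
Local Notation eta := (@eta n).

(* The powers of D dominate; the column index i breaks ties, so that among the generators
   on which the bracket with e_{i-1,j} has a constant term e_{ji} is strictly heaviest. *)
Definition wt (g : Gen n) : nat := N * g.2.+1 + g.1.2.
Definition wtw (w : seq (Gen n)) : nat := sumn (map wt w).

Lemma wtw_cat u v : wtw (u ++ v) = (wtw u + wtw v)%N.
Proof. by rewrite /wtw map_cat sumn_cat. Qed.

Lemma wtw_cons x w : wtw (x :: w) = (wt x + wtw w)%N.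
Proof. by []. Qed.

Lemma wtw_perm_inv (P : pred nat) : perm_inv (P \o wtw).
Proof. by move=> u v uv; rewrite /= /wtw (perm_sumn (perm_map wt uv)). Qed.

Lemma wtw_D w : suppin (fun u => wtw u == (wtw w + N)%N) (D (mon w)).
Proof.
elim: w => [|x w IH]; first by rewrite mon_nil D1; apply: suppin0.
rewrite mon_cons DM; apply: suppinD.
  have -> : D (gen x) = gen (Dg x) by exact: dif_gen.
  rewrite -mon_cons; apply: (suppin_mon (wtw_perm_inv (fun k => k == _))).
  by rewrite /wtw /= /wt /= mulnS; lia.
rewrite sg_gen -scalerAl; apply: suppinZ.
apply: (suppinM (Q := fun u => wtw u == wt x)) IH; first exact: (wtw_perm_inv (fun k => k == _)).
- by move=> u v /eqP hu /eqP hv; rewrite wtw_cat hu hv /wtw /=; lia.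
- apply: (suppin_mon (wtw_perm_inv (fun k => k == _))).
  by rewrite /wtw /= addn0.
Qed.

(** The offset [q] stands in for a lower bound r - q without truncated subtraction. *)
Lemma suppin_D r q s : suppin (fun u => r <= wtw u + q)%N s ->
  suppin (fun u => r + N <= wtw u + q)%N (D s).
Proof.
move: s; apply: suppin_ind => [|s t hs ht|c w hw].
- by rewrite linear0; apply: suppin0.
- by rewrite linearD; apply: suppinD.
rewrite linearZ; apply: suppinZ; apply: suppinW (@wtw_D w) => u /eqP ->; lia.
Qed.

Definition cstR (g : Gen n) : CC :=
  if isP g then 0 else if g.2 == 0%N then form (fmat n) (delta_mx g.1.1 g.1.2) else 0.

(** Every letter weighs at least N. *)
Lemma phiR_split g : suppin (fun u => N <= wtw u)%N (phiR g - (cstR g)%:A).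
Proof.
rewrite /phiR /cstR; case: ifP => _; last by rewrite subrr; apply: suppin0.
rewrite scale0r subr0; apply: (suppin_mon (wtw_perm_inv (fun k => N <= k)%N)).
by rewrite /wtw /= /wt; lia.
Qed.

Section LeadingTerm.
Variables (a b i : Idx n).
Hypotheses (ia : i = a.+1 :> nat) (ib : (i <= b)%N).
Let s := pI a (+) pI b.

(** Up to sign this is (f|[e_ab, e_pq]), the constant term modulo J at chi^0. *)
Definition kap (p q : Idx n) : CC := sgn (s && ~~ (pI p (+) pI q)) *
  ((if b == p then cstR (a, q, 0%N) else 0) -
   sgn (s && (pI p (+) pI q)) * (if a == q then cstR (p, b, 0%N) else 0)).

(** The sign with which the chi^0 term for e_pq reaches chi^l in the bracket with its l-th
    derivative. *)
Fixpoint eps (l : nat) : CC :=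
  if l is l'.+1 then - sgn (s (+) odd l) * eps l' else 1.

Lemma eps_neq0 l : eps l != 0.
Proof.
by elim: l => [|l IH] /=; rewrite ?oner_eq0 // mulf_neq0 // oppr_eq0 sgn_neq0.
Qed.

(** The bracket of e_ab with e_bi contains e_ai = e_(a,a+1), which pairs with f. *)
Lemma kap_neq0 : kap b i != 0.
Proof.
have ai : a == i = false by rewrite -val_eqE /= ia ltn_eqF.
rewrite /kap eqxx ai mulr0 subr0 mulf_neq0 ?sgn_neq0 // /cstR /isP /= ia ltnn.
by rewrite form_f_delta ia eqxx sgn_neq0.
Qed.

Lemma kap_eq0 (p q : Idx n) : (p, q) != (b, i) -> q != a -> kap p q = 0.
Proof.
move=> pq qa; rewrite /kap (eq_sym a) (negbTE qa) mulr0 subr0.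
case: eqP => [bp|_]; last by rewrite mulr0.
rewrite /cstR form_f_delta /=; case: ifP => _; first by rewrite mulr0.
case: eqP => [e|_]; last by rewrite mulr0.
case/eqP: pq; rewrite bp; congr (_, _); apply: val_inj; by rewrite /= e ia.
Qed.

(** Each of the l derivatives either acts as D, adding N to the weight, or raises the power of chi.
    Only the constant [kap] lies below the resulting bound; as D kills constants, it survives only
    at m = l. *)
Lemma rho_dgen m p q l :
  suppin (fun u => N * l.+1 <= wtw u + N * m)%N
    (rho (dgen a b m (p, q, l)) - (if m == l then eps l * kap p q else 0)%:A).
Proof.
elim: l m => [|l IH] m.
  rewrite dgen0; case: m => [|[|m]].
  - rewrite eqxx mul1r linearZ bar_sbr linearB linearZ /= /kap -/s.
    have E (e e' : CC) (u u' v v' : S) :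
        e *: (u - e' *: v) - e *: (u' - e' *: v') = e *: (u - u' - e' *: (v - v')).
      by rewrite -scalerBr; congr (_ *: _); rewrite scalerBr !opprD !opprK addrACA.
    rewrite -scalerA scalerBl -scalerA E; apply/suppinZ/suppinD; last first.
      apply/suppinN/suppinZ; case: ifP => _; last first.
        by rewrite linear0 scale0r subr0; apply: suppin0.
      rewrite rho_gen muln1 muln0; apply: suppinW (@phiR_split _) => u; lia.
    case: ifP => _; last by rewrite linear0 scale0r subr0; apply: suppin0.
    rewrite rho_gen muln1 muln0; apply: suppinW (@phiR_split _) => u; lia.
  - rewrite /= scale0r subr0 linearZ /= rmorph1; apply: suppinZ.
    apply: (suppin_mon (w := [::]) (wtw_perm_inv (fun k => N * 1 <= k + N * 1)%N)).
    by rewrite /wtw /=; lia.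
  - by rewrite linear0 /= scale0r subrr; apply: suppin0.
have hD := suppin_D (IH m).
rewrite linearB /= Dcst subr0 -rho_D in hD.
rewrite dgenS linearZ linearB /= -/s.
case: m hD => [|m] hD.
  rewrite /= linear0 subr0 scale0r subr0; apply: suppinZ.
  by apply: suppinW hD => u; lia.
have -> : (if m.+1 == l.+1 then - sgn (s (+) ~~ odd l) * eps l * kap p q else 0)%:A =
    - (sgn (s (+) odd m.+1) *: (if m == l then eps l * kap p q else 0)%:A) :> S.
  rewrite eqSS; case: eqP => [->|_]; last by rewrite scale0r scaler0 oppr0.
  by rewrite /= scalerA -scaleNr !mulNr mulrA.
rewrite opprK -scalerDr; apply: suppinZ.
rewrite -addrA [- _ + _]addrC -opprB; apply: suppinD; first by apply: suppinW hD => u; lia.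
by apply: suppinN; apply: suppinW (IH m) => u; lia.
Qed.

(** For [x = (p, q, l')] the terms bounded by [rho_dgen] weigh at least N(l' - l + 1), more than
    N(l' - l) + q - i since q < N. Any other remaining constant has l' = l and q = a < i, where the
    tie-break in the weight decides. *)
Lemma rho_del_gen x l :
  suppin (fun u => wt x < wtw u + wt (b, i, l))%N
    (rho (del a b l (gen x)) - (eps l * kap b i) *: (x == (b, i, l))%:R).
Proof.
rewrite del_gen; case: x => [[p q] l'].
have qN := ltn_ord q.
pose c := (if l == l' then eps l' * kap p q else 0)%:A : S.
rewrite -[rho _](subrK c) -addrA; apply: suppinD.
  by apply: suppinW (@rho_dgen l p q l') => u; rewrite /wt /=; lia.
rewrite /c; case: (eqVneq (p, q) (b, i)) => [[-> ->]|pq].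
  rewrite (eq_sym l) (_ : ((b, i, l') == (b, i, l)) = (l' == l)); last first.
    by rewrite xpair_eqE eqxx.
  case: eqP => [->|_]; rewrite ?subrr ?scale0r ?scaler0 ?subrr; exact: suppin0.
have -> : ((p, q, l') == (b, i, l)) = false by rewrite xpair_eqE (negbTE pq).
rewrite scaler0 subr0; case: eqP => [<-|_]; last by rewrite scale0r; apply: suppin0.
case: (eqVneq q a) => [->|qa]; last by rewrite kap_eq0 // mulr0 scale0r; apply: suppin0.
apply/suppinZ/(suppin_mon (w := [::]) (wtw_perm_inv (fun k => _ < k + _)%N)).
by rewrite /wtw /wt /=; lia.
Qed.

(** Since i = a+1, the bracket coefficient and the partial derivative have the same parity. Their
    difference therefore obeys the Leibniz rule, and the gain in weight on one letter carries over
    to words. *)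
Lemma rho_del_mon w l : all (@isP n) w ->
  suppin (fun u => wtw w < wtw u + wt (b, i, l))%N
    (rho (del a b l (mon w)) - (eps l * kap b i) *: pd (b, i, l) (mon w)).
Proof.
elim: w => [|x w IH] /=.
  by rewrite mon_nil del1 /pd der1 linear0 scaler0 subrr => _; apply: suppin0.
case/andP=> Px /[dup] Pw /IH{}IH.
have -> : rho (del a b l (mon (x :: w))) - (eps l * kap b i) *: pd (b, i, l) (mon (x :: w)) =
  (rho (del a b l (gen x)) - (eps l * kap b i) *: (x == (b, i, l))%:R) * mon w +
  sgn (parG (b, i, l) && parG x) *: (gen x *
   (rho (del a b l (mon w)) - (eps l * kap b i) *: pd (b, i, l) (mon w))).
  rewrite pd_mon_cons mon_cons delM rmorphD !rmorphM /= rho_sg rho_mon //.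
  rewrite rho_gen /phiR Px sg_gen mulrBl mulrBr scalerBr scalerDr opprD addrACA.
  rewrite -!scalerAl -!scalerAr; congr (_ + _ + (sgn (_ && _) *: _ - _)).
    by rewrite /parG /pI /= ia oddS; case: (odd a); case: (odd b); case: (odd l).
  by rewrite !scalerA mulrC.
apply: suppinD; last apply: suppinZ.
  apply: (suppinM (wtw_perm_inv (fun k => _ < k + _)%N)) (@rho_del_gen x l)
    (suppin_mon (w := w) (wtw_perm_inv (fun k => k == wtw w)) _) => //=.
  by move=> u v h /eqP hv; rewrite wtw_cat wtw_cons hv addnAC ltn_add2r.
apply: (suppinM (wtw_perm_inv (fun k => _ < k + _)%N))
    (suppin_mon (w := [:: x]) (wtw_perm_inv (fun k => k == wt x)) _) IH => //=.
  by move=> u v /eqP hu h; rewrite wtw_cat wtw_cons hu -addnA ltn_add2l.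
by rewrite /wtw /= addn0.
Qed.

End LeadingTerm.

Definition phiZ (y : Sym n) : S := sgn (pI y.1) *: gen (y.1, ord0, y.2).

Lemma phiZ_comm : supercomm (@parY n) phiZ.
Proof.
move=> x y; rewrite /phiZ -!scalerAl -!scalerAr gen_swap !scalerA.
congr (_ *: _); rewrite mulrC -mulrA; congr (sgn (_ && _) * _); last exact: mulrC.
- by rewrite /parG /parY /pI /= oddD addbF; case: odd; case: odd.
- by rewrite /parG /parY /pI /= oddD addbF; case: odd; case: odd.
Qed.

(** Puts the symbols back as generators of row 0, so that [zeta] after [eta] keeps the monomials in
    these generators and kills all others. *)
Definition zeta : SY -> S := ahom phiZ_comm.
HB.instance Definition _ := GRing.LRMorphism.copy zeta (ahom phiZ_comm).

Definition col0 (g : Gen n) := g.1.2 == 0%N :> nat.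

Lemma zeta_eta_mon w : zeta (eta (mon w)) = if all col0 w then mon w else 0.
Proof.
elim: w => [|x w IH] /=; first by rewrite mon_nil !rmorph1.
rewrite mon_cons !rmorphM /= IH eta_gen /phiE -/(col0 x).
case: ifP => x0; last by rewrite linear0 mul0r.
rewrite linearZ /= /zeta ahom_gen /phiZ scalerA sgnK scale1r.
case: ifP => _; last by rewrite mulr0.
congr (gen _ * _); case: x x0 => [[c d] l] /= /eqP d0.
by congr (_, _, _); apply: val_inj; rewrite /= -d0.
Qed.

Lemma coefS_zeta_eta s m : all col0 m -> coefS (zeta (eta s)) m = coefS s m.
Proof.
move=> m0; elim/mon_ind: s => [|s t hs ht|c w].
- by rewrite !linear0.
- by rewrite !linearD !coefSD /= hs ht.
rewrite !linearZ !coefSZ /= zeta_eta_mon; case: ifP => // w0; congr (_ * _).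
rewrite coefS0; apply/esym/eqP; apply: contraFT w0 => /coefS_mon_perm h.
by rewrite -(perm_all _ h).
Qed.

Lemma eta_WS_inj s : WS s -> eta s = 0 -> s = 0.
Proof.
move=> [hs ds] es; apply: coefS_inj => m; rewrite coefS0.
(* Induction on the weight: all lighter monomials already have coefficient 0, so if m occurs in s it
   has least weight there. *)
have [d] := ubnP (wtw m); elim: d => // d IHd in m * => md.
apply/eqP/negPn/negP => hm.
have Pm : all (@isP n) m by move/rho_id: hs; apply.
suff m0 : all col0 m.
  by move: hm; rewrite -(coefS_zeta_eta s m0) es linear0 coefS0 eqxx.
apply/allP => -[[b i] l] gm; rewrite /col0 /=; apply/negPn/negP => i0.
have ib : (i <= b)%N by move/allP: Pm => /(_ _ gm).
have aN : (i.-1 < N)%N by apply: leq_ltn_trans (leq_pred _) (ltn_ord i).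
pose a : Idx n := Ordinal aN.
have ia : i = a.+1 :> nat by rewrite /= prednK // lt0n.
have ab : (a < b)%N by rewrite -ia.
pose c := eps a b l * kap a b b i.
have c0 : c != 0 by rewrite mulf_neq0 ?eps_neq0 // kap_neq0.
have sQ : suppin (fun u => all (@isP n) u && (wtw m <= wtw u)%N) s.
  move=> u hu; move/rho_id: (hs) => ->//=; rewrite leqNgt; apply/negP => um.
  by move/eqP: hu; apply; apply: IHd; lia.
have : suppin (fun u => wtw m < wtw u + wt (b, i, l))%N
    (rho (del a b l s) - c *: pd (b, i, l) s).
  move: {hs ds es IHd hm} s sQ; apply: suppin_ind => [|u v hu hv|e w /andP[Pw mw]].
  - by rewrite !linear0 ?subr0 ?addr0; apply: suppin0.
  - by rewrite !linearD /= addrACA; apply: suppinD.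
  rewrite !linearZ /= scalerA mulrC -scalerA -scalerDr scalerN; apply: suppinZ.
  by apply: suppinW (rho_del_mon ia ib (l := l) Pw) => u; apply: leq_ltn_trans.
(* By invariance the bracket is 0, so the weight bound falls on the partial derivative alone. *)
rewrite ds // sub0r => /suppinN; rewrite opprK => /(suppinZ (c := c^-1)).
rewrite scalerA mulVf // scale1r => hpd.
have hg : suppin (fun u => wtw m < wtw u)%N (gen (b, i, l) * pd (b, i, l) s).
  apply: (suppinM (wtw_perm_inv (fun k => _ < k)%N))
    (suppin_mon (w := [:: (b, i, l)]) (wtw_perm_inv (fun k => k == wt (b, i, l))) _) hpd.
    by move=> u v /eqP hu hv; rewrite /= wtw_cat hu addnC.
  by rewrite /wtw /= addn0.
(* As m contains the generator, its coefficient here is a positive integer times its coefficient in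
   s, hence nonzero; then m would weigh more than itself. *)
have := hg m; rewrite coefS_gen_pd mulf_neq0 // ?ltnn; first by move/(_ isT).
by rewrite CC_natr_eq0 -lt0n -has_count has_pred1.
Qed.

End Generation.

(** * Degree bound, invariance, freeness and generation *)

Theorem mainTheorem3 (n : nat) (hn : (1 <= n)%N) :
  (forall i : nat, (N n < i)%N -> sceq (@parG n) (nth [::] (rdet n) i) [::]) /\
  (forall k : 'I_(N n), inW (wcoef n k.+1)) /\
  (forall P Q : sc (Sym n),
      sceq (@parG n) (evalY P) (evalY Q) -> sceq (@parY n) P Q) /\
  (forall x : V n, inW x <-> exists P : sc (Sym n), sceq (@parG n) x (evalY P)).
Proof.
split; last split; last split.
- move=> i hi; apply/clsP; rewrite cls_nth_rdet tS_high // addn0 //.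
- by move=> k; apply/inWP; rewrite /wcoef cls_nth_rdet; apply: WS_tS0.
- by move=> P Q /clsP h; apply/clsP; rewrite -!eta_evalY h.
move=> x; rewrite inWP; split=> [hx|[P /clsP ->]]; last exact: WS_evalY.
(* The polynomial is read off from [eta] of x; its value differs from x by an element of W that
   [eta] kills. *)
exists (repr (eta (cls (@parG n) x))); apply/clsP/eqP; rewrite -subr_eq0; apply/eqP.
apply: eta_WS_inj.
  by rewrite -scaleN1r; apply: WSD hx (WSZ _ (WS_evalY _)).
by rewrite linearB /= eta_evalY cls_repr subrr.
Qed.
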